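(* Let $G$ be a non-elementary generalized Baumslag–Solitar group, let $\mathcal D$ be its cyclic deformation space, and let $g\in G$ be a loxodromic element. If $g$ is simple, then for every $T\in\mathcal D$ there exists a vertex $v\in T$ such that the Whitehead graph $Wh_T(g,v)$ has an admissible cut.
   Context: A generalized Baumslag–Solitar (GBS) group is the fundamental group of a finite graph of groups all of whose vertex and edge groups are infinite cyclic. It is non-elementary if it is not isomorphic to $\mathbb Z$, $\mathbb Z^2$ or the Klein bottle group $\langle a,t\mid tat^{-1}=a^{-1}\rangle$. A $G$-tree is a simplicial tree with a minimal action of $G$ by simplicial automorphisms without inversions of edges. The cyclic deformation space $\mathcal D$ is the set of all $G$-trees whose vertex and edge stabilizers are all infinite cyclic. For $G$ non-elementary, all trees in $\mathcal D$ have the same elliptic subgroups (a subgroup is elliptic if it fixes a vertex). An element of $G$ is loxodromic if it fixes no point in one (equivalently, every) tree of $\mathcal D$; it then has an axis in each $T\in\mathcal D$. Given a $G$-tree $T$ and a $G$-invariant subforest $F\subset T$, the collapse of $F$ is the $G$-tree obtained by contracting each connected component of $F$ to a point. A special factor (with respect to $\mathcal D$) is a subgroup $H<G$ which is the stabilizer of a point in some $G$-tree obtained from a tree of $\mathcal D$ by collapsing a (possibly empty, possibly full) $G$-invariant subforest, and which is not elliptic in $\mathcal D$. (Equivalently, a non-cyclic subgroup which is, up to conjugacy, the fundamental group of a connected subgraph of groups of some graph of infinite cyclic groups with fundamental group $G$.) It is proper if $H\ne G$. A loxodromic element $g$ is simple if there is a proper special factor containing $g$. Whitehead graph: for $T\in\mathcal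 D$ and a vertex $v\in T$, $Wh_T(g,v)$ is the simplicial graph whose vertex set is the set of oriented edges of $T$ with origin $v$; two distinct vertices $e,e'$ are joined by an edge if and only if some $G$-translate of the axis of $g$ in $T$ contains $e\cup e'$. This graph has an admissible cut if it is disconnected or has a cut vertex (a vertex $p$ such that, if $W_0$ is the connected component containing $p$, $W_0\setminus\{p\}$ is disconnected). *)

(* Defs.v *)
From HB Require Import structures.
From mathcomp Require Import all_boot all_algebra.
From mathcomp Require Import boolp classical_sets cardinality.
From Stdlib Require Import Relations.Relation_Operators.

Set Implicit Arguments.
Unset Strict Implicit.
Unset Printing Implicit Defensive.

Local Open Scope classical_set_scope.
Local Open Scope group_scope.

Definition iso_subgroup (V : zmodType) (G : groupType) (H : set G) : Prop :=
  exists phi : V -> G,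
    [/\ injective phi, (forall x y, phi (x + y)%R = phi x * phi y)
      & range phi = H].

Definition infinite_cyclic (G : groupType) (H : set G) : Prop :=
  iso_subgroup int H.

(* In a word over X, the letter (x, false) stands for x and (x, true) for its
   formal inverse. *)
Definition word (X : Type) := seq (X * bool).

Inductive word_eq (X : Type) (R : set (word X)) : word X -> word X -> Prop :=
| word_eq_refl u : word_eq R u u
| word_eq_sym u v : word_eq R u v -> word_eq R v u
| word_eq_trans u v w : word_eq R u v -> word_eq R v w -> word_eq R u w
| word_eq_cancel u x b v :
    word_eq R (u ++ [:: (x, b); (x, ~~ b)] ++ v) (u ++ v)
| word_eq_relator u r v : R r -> word_eq R (u ++ r ++ v) (u ++ v).

Definition word_val (X : Type) (G : groupType) (f : X -> G) (w : word X) : G :=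
  foldr (fun a y => (if a.2 then (f a.1)^-1 else f a.1) * y) 1 w.

(* f induces an isomorphism from the presented group < X | R > onto G. *)
Definition presents (X : Type) (G : groupType) (f : X -> G)
    (R : set (word X)) : Prop :=
  (forall x : G, exists w, word_val f w = x) /\
  (forall w, word_val f w = 1 <-> word_eq R w [::]).

(* < a, t | t a t^-1 a >, with a = false and t = true. *)
Definition klein_bottle_group (G : groupType) : Prop :=
  exists f : bool -> G, presents f
    [set [:: (true, false); (false, false); (true, true); (false, false)]].

Definition elementary (G : groupType) : Prop :=
  [\/ iso_subgroup int [set: G], iso_subgroup (int * int)%type [set: G]
    | klein_bottle_group G].

(* Graphs in the sense of Serre: an unoriented edge is a pair {e, bar e}. *)
Record graph := Graph {
  vert : Type;
  edge : Type;
  org : edge -> vert;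
  bar : edge -> edge;
  barK : forall e, bar (bar e) = e;
  bar_neq : forall e, bar e <> e }.

Definition tgt (Y : graph) (e : edge Y) : vert Y := org (bar e).

Fixpoint walk (Y : graph) (B : set (edge Y)) (v : vert Y) (p : seq (edge Y))
    (w : vert Y) : Prop :=
  if p is e :: p' then [/\ B e, org e = v & walk B (tgt e) p' w] else v = w.

Definition reduced (Y : graph) (p : seq (edge Y)) : Prop :=
  forall p1 e p2, p <> p1 ++ [:: e; bar e] ++ p2.

Record subgraph (Y : graph) := Subgraph {
  sv : set (vert Y);
  se : set (edge Y);
  se_bar : forall e, se e -> se (bar e);
  se_org : forall e, se e -> sv (org e) }.

Definition is_subtree (Y : graph) (F : subgraph Y) : Prop :=
  [/\ sv F !=set0,
      (forall v w, sv F v -> sv F w -> exists p, walk (se F) v p w)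
    & (forall v p, walk (se F) v p v -> reduced p -> p = [::])].

Definition full_subgraph (Y : graph) : subgraph Y :=
  @Subgraph Y setT setT (fun _ _ => I) (fun _ _ => I).

Definition is_tree (Y : graph) : Prop := is_subtree (full_subgraph Y).

(* The edges of a graph of groups are given with one chosen orientation each;
   the edge group of e embeds into the groups of the origin and the terminus
   of e. *)
Record graph_of_groups := GraphOfGroups {
  gv : Type;
  ge : Type;
  gsrc : ge -> gv;
  gtgt : ge -> gv;
  vgroup : gv -> groupType;
  egroup : ge -> groupType;
  msrc : forall e, egroup e -> vgroup (gsrc e);
  mtgt : forall e, egroup e -> vgroup (gtgt e);
  msrcM : forall e (x y : egroup e), msrc (x * y) = msrc x * msrc y;
  mtgtM : forall e (x y : egroup e), mtgt (x * y) = mtgt x * mtgt y;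
  msrc_inj : forall e, injective (@msrc e);
  mtgt_inj : forall e, injective (@mtgt e) }.

Section UnderlyingGraph.
Variable Y : graph_of_groups.

Definition uorg (e : ge Y * bool) := if e.2 then gtgt e.1 else gsrc e.1.
Definition ubar (e : ge Y * bool) := (e.1, ~~ e.2).

Lemma ubarK e : ubar (ubar e) = e.
Proof. by case: e => e b; rewrite /ubar /= negbK. Qed.

Lemma ubar_neq e : ubar e <> e.
Proof. by case: e => e []. Qed.

(* (e, false) is the edge e with its chosen orientation. *)
Definition underlying_graph : graph := Graph uorg ubarK ubar_neq.

Definition spanning_subgraph (B : set (ge Y)) : subgraph underlying_graph :=
  @Subgraph underlying_graph setT [set e | B e.1] (fun _ h => h) (fun _ _ => I).

Definition maximal_tree (B : set (ge Y)) : Prop :=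
  is_subtree (spanning_subgraph B).

End UnderlyingGraph.

Definition pi1_gen (Y : graph_of_groups) := ({v : gv Y & vgroup v} + ge Y)%type.

Definition pi1_vertex (Y : graph_of_groups) (v : gv Y) (x : vgroup v) :
  pi1_gen Y := inl (existT _ v x).

Definition pi1_stable (Y : graph_of_groups) (e : ge Y) : pi1_gen Y := inr e.

(* Multiplication tables of the vertex groups, t_e mtgt(c) t_e^-1 = msrc(c) for
   c in the group of e, and t_e = 1 for e in the maximal tree B. *)
Inductive pi1_relator (Y : graph_of_groups) (B : set (ge Y)) :
    word (pi1_gen Y) -> Prop :=
| pi1_mul v (x y : vgroup v) :
    pi1_relator B [:: (pi1_vertex x, false); (pi1_vertex y, false);
                      (pi1_vertex (x * y), true)]
| pi1_edge e (c : egroup e) :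
    pi1_relator B [:: (pi1_stable e, false); (pi1_vertex (mtgt c), false);
                      (pi1_stable e, true); (pi1_vertex (msrc c), true)]
| pi1_tree e : B e -> pi1_relator B [:: (pi1_stable e, false)].

Definition is_fundamental_group (Y : graph_of_groups) (G : groupType) : Prop :=
  exists B : set (ge Y), maximal_tree B /\
    exists f : pi1_gen Y -> G, presents f (pi1_relator B).

Definition GBS (G : groupType) : Prop :=
  exists Y : graph_of_groups,
    [/\ finite_set [set: gv Y] /\ finite_set [set: ge Y],
        (forall v : gv Y, infinite_cyclic [set: vgroup v]),
        (forall e : ge Y, infinite_cyclic [set: egroup e])
      & is_fundamental_group Y G].

Record Ggraph (G : groupType) := GGraph {
  ggraph :> graph;
  vact : G -> vert ggraph -> vert ggraph;
  eact : G -> edge ggraph -> edge ggraph;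
  vact1 : forall v, vact 1 v = v;
  vactM : forall g h v, vact (g * h) v = vact g (vact h v);
  eact1 : forall e, eact 1 e = e;
  eactM : forall g h e, eact (g * h) e = eact g (eact h e);
  eact_org : forall g e, org (eact g e) = vact g (org e);
  eact_bar : forall g e, bar (eact g e) = eact g (bar e) }.

Definition G_invariant (G : groupType) (T : Ggraph G) (F : subgraph T) : Prop :=
  (forall g v, sv F v -> sv F (vact g v)) /\
  (forall g e, se F e -> se F (eact g e)).

Definition minimal_action (G : groupType) (T : Ggraph G) : Prop :=
  forall F : subgraph T, is_subtree F -> G_invariant F ->
    sv F = setT /\ se F = setT.

Definition is_Gtree (G : groupType) (T : Ggraph G) : Prop :=
  [/\ is_tree T, (forall (g : G) (e : edge T), eact g e <> bar e)
    & minimal_action T].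

Definition vstab (G : groupType) (T : Ggraph G) (v : vert T) : set G :=
  [set g | vact g v = v].

Definition estab (G : groupType) (T : Ggraph G) (e : edge T) : set G :=
  [set g | eact g e = e].

(* In the absence of inversions all interior points of an edge have the same
   stabilizer, so inr e stands for any interior point of the edge e. *)
Definition point (G : groupType) (T : Ggraph G) := (vert T + edge T)%type.

Definition pstab (G : groupType) (T : Ggraph G) (x : point T) : set G :=
  match x with inl v => vstab v | inr e => estab e end.

Definition cyclic_deformation_space (G : groupType) (T : Ggraph G) : Prop :=
  [/\ is_Gtree T, (forall v : vert T, infinite_cyclic (vstab v))
    & (forall e : edge T, infinite_cyclic (estab e))].

Definition elliptic_in (G : groupType) (T : Ggraph G) (H : set G) : Prop :=
  exists v : vert T, H `<=` vstab v.

Definition elliptic (G : groupType) (H : set G) : Prop :=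
  forall T : Ggraph G, cyclic_deformation_space T -> elliptic_in T H.

Definition loxodromic (G : groupType) (g : G) : Prop :=
  exists2 T : Ggraph G, cyclic_deformation_space T
    & forall x : point T, ~ pstab x g.

(* A vertex outside F, or isolated in F, is its own component. *)
Definition component (Y : graph) (F : subgraph Y) (v : vert Y) : set (vert Y) :=
  [set w | exists p, walk (se F) v p w].

(* The vertices of the collapse are the sets of vertices of T that are
   contracted to a point, its edges are the edges of T not in F. *)
Section Collapse.
Variables (G : groupType) (T : Ggraph G) (F : subgraph T).
Hypothesis invF : G_invariant F.

Definition cvert : Type := range (component F).
Definition cedge : Type := ~` se F.

Definition cpt (v : vert T) : cvert := SigSub (mem_set (imageT (component F) v)).

Definition corg (e : cedge) : cvert := cpt (org (val e)).

Lemma cbar_subproof (e : cedge) : bar (val e) \in ~` se F.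
Proof.
apply/mem_set => /(@se_bar _ F); rewrite barK.
by have := set_mem (valP e).
Qed.

Definition cbar (e : cedge) : cedge := SigSub (cbar_subproof e).

Lemma cbarK e : cbar (cbar e) = e.
Proof. by apply: val_inj; rewrite /= barK. Qed.

Lemma cbar_neq e : cbar e <> e.
Proof. by move=> /(congr1 val) /=; exact: bar_neq. Qed.

Definition collapse_graph : graph := Graph corg cbarK cbar_neq.

Lemma vactK (g : G) : cancel (@vact G T g) (vact g^-1).
Proof. by move=> v; rewrite -vactM mulVg vact1. Qed.

Lemma eactK (g : G) : cancel (@eact G T g) (eact g^-1).
Proof. by move=> e; rewrite -eactM mulVg eact1. Qed.

Lemma walk_act (g : G) v p w :
  walk (se F) v p w -> walk (se F) (vact g v) (map (eact g) p) (vact g w).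
Proof.
elim: p v => [|e p IH] v /=; first by move->.
move=> [Fe <- /IH]; rewrite /tgt eact_bar !eact_org => pw; split=> //.
exact: invF.2.
Qed.

Lemma component_act (g : G) v :
  vact g @` component F v = component F (vact g v).
Proof.
apply/seteqP; split=> [_ [w [p pw] <-]|w [p pw]].
  by exists (map (eact g) p); exact: walk_act.
exists (vact g^-1 w); last by rewrite -vactM mulgV vact1.
by exists (map (eact g^-1) p); rewrite -{1}(vactK g v); exact: walk_act.
Qed.

Lemma cvact_subproof (g : G) (x : cvert) :
  vact g @` val x \in range (component F).
Proof.
apply/mem_set; have [v _ <-] := set_mem (valP x).
by exists (vact g v) => //; rewrite component_act.
Qed.

Definition cvact (g : G) (x : cvert) : cvert := SigSub (cvact_subproof g x).

Lemma ceact_subproof (g : G) (e : cedge) : eact g (val e) \in ~` se F.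
Proof.
apply/mem_set => /(invF.2 g^-1); rewrite eactK.
by have := set_mem (valP e).
Qed.

Definition ceact (g : G) (e : cedge) : cedge := SigSub (ceact_subproof g e).

Lemma cvact1 x : cvact 1 x = x.
Proof.
apply: val_inj => /=; have := set_mem (valP x) => -[v _ <-].
by rewrite component_act vact1.
Qed.

Lemma cvactM g h x : cvact (g * h) x = cvact g (cvact h x).
Proof.
apply: val_inj => /=; have := set_mem (valP x) => -[v _ <-].
by rewrite !component_act vactM.
Qed.

Lemma ceact1 e : ceact 1 e = e.
Proof. by apply: val_inj; rewrite /= eact1. Qed.

Lemma ceactM g h e : ceact (g * h) e = ceact g (ceact h e).
Proof. by apply: val_inj; rewrite /= eactM. Qed.

Lemma ceact_org g e : corg (ceact g e) = cvact g (corg e).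
Proof. by apply: val_inj; rewrite /= component_act eact_org. Qed.

Lemma ceact_bar g e : cbar (ceact g e) = ceact g (cbar e).
Proof. by apply: val_inj; rewrite /= eact_bar. Qed.

Definition collapse : Ggraph G :=
  @GGraph G collapse_graph cvact ceact cvact1 cvactM ceact1 ceactM
    ceact_org ceact_bar.

End Collapse.

Definition special_factor (G : groupType) (H : set G) : Prop :=
  (exists S : Ggraph G, cyclic_deformation_space S /\
    exists (F : subgraph S) (invF : G_invariant F) (x : point (collapse invF)),
      H = pstab x) /\
  ~ elliptic H.

Definition simple_element (G : groupType) (g : G) : Prop :=
  exists H : set G, [/\ special_factor H, H <> setT & H g].

(* l is a bi-infinite geodesic along which g translates. *)
Definition axis_line (G : groupType) (T : Ggraph G) (g : G)
    (l : int -> edge T) : Prop :=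
  (forall n : int, tgt (l n) = org (l (n + 1)%R) /\ l (n + 1)%R <> bar (l n)) /\
  (exists2 k : int, (0 < k)%R & forall n : int, eact g (l n) = l (n + k)%R).

(* The axis is unique when T is a tree; it is given by its oriented edges, with
   both orientations. *)
Definition axis (G : groupType) (T : Ggraph G) (g : G) : set (edge T) :=
  [set e | exists2 l : int -> edge T, axis_line g l
         & exists n, e = l n \/ e = bar (l n)].

Arguments axis {G} T g.

Record sgraph := SGraph {
  sgpoint :> Type;
  vertices : set sgpoint;
  adj : sgpoint -> sgpoint -> Prop }.

Arguments vertices : clear implicits.

Definition induced (W : sgraph) (A : set W) : sgraph :=
  SGraph (vertices W `&` A) (@adj W).

Definition connected_in (W : sgraph) (x y : W) : Prop :=
  clos_refl_trans W
    (fun x y : W => [/\ vertices W x, vertices W y & adj x y]) x y.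

Definition disconnected (W : sgraph) : Prop :=
  exists x y : W, [/\ vertices W x, vertices W y & ~ connected_in x y].

Definition cut_vertex (W : sgraph) (p : W) : Prop :=
  vertices W p /\ disconnected (induced (connected_in p `\ p)).

Definition admissible_cut (W : sgraph) : Prop :=
  disconnected W \/ exists p : W, cut_vertex p.

Definition Wh (G : groupType) (T : Ggraph G) (g : G) (v : vert T) : sgraph :=
  SGraph [set e : edge T | org e = v]
    (fun e e' => e <> e' /\
       exists h : G, [set e; e'] `<=` [set eact h x | x in axis T g]).

Arguments Wh {G} T g v.

(* Main.v *)
Require Import Defs.
From mathcomp Require Import all_boot all_order all_algebra zify.
From mathcomp Require Import boolp classical_sets cardinality.

Set Implicit Arguments.
Unset Strict Implicit.
Unset Printing Implicit Defensive.

Import Order.TTheory GRing.Theory Num.Theory.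

Local Open Scope classical_set_scope.

(** Some tree S of the deformation space has an invariant subforest F one of
whose components is stabilized by g, and F is not all of S.  An edge e of S
outside F cuts S into two half-trees.  As the component of g and its translates
miss e, no translate of the axis of g runs from one half-tree to the other
(simple_missed_edge).

Let T be any tree of the deformation space, f : T -> S an equivariant map of
vertices, and colour a vertex w of T by the half-tree that contains f w.  Three
facts about this colouring carry the proof.
- The colour changes only along edges at bounded distance from some vertex r
  (bounded_cut).  The edges of T whose images in S cross e form finitely
  many orbits under the stabilizer of e, and that stabilizer fixes a vertex r of T.
- Both colours occur arbitrarily far from r (far_both_sides).  The edges of S
  for which this holds span an invariant subtree, which is nonempty since it
  contains the axis of g, hence is S by minimality.
- Both ends of every translate of the axis of g have the same colour
  (axis_side).

Call an oriented edge of T pure if all vertices beyond it and far from r have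
one colour.  Edges far from r that point away from r are pure, but T as a whole
carries both colours far away.  Hence there is a last vertex v, going away from
r, that still sees both colours: every edge at v other than the edge p back to
r is pure, and both colours occur among these edges (branching).  Edges at v
other than p that are joined in the Whitehead graph lie on a translate of the
axis of g, so they have the same colour.  Thus the Whitehead graph is
disconnected, or p is a cut vertex of it (whitehead_cut).

That f and r exist amounts to: a vertex stabilizer of T fixes a vertex of S,
and conversely (vstab_elliptic).  All vertex stabilizers of T are commensurable
to each other, so if a generator of one of them had an axis in S, this axis
would be invariant under G and would be all of S.  A group that acts on a line
with infinite cyclic stabilizers and without inversions is Z^2 or the Klein
bottle group (line_elementary), which are excluded.  A GBS group is
finitely generated, so by minimality T has finitely many orbits of edges
(edge_orbits), as bounded_cut requires. *)

(** * Walks, half-trees and distances *)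

Section Walks.
Variable Y : graph.
Implicit Types (B : set (edge Y)) (u v w : vert Y) (e a : edge Y).

Lemma tgt_bar e : tgt (bar e) = org e.
Proof. by rewrite /tgt barK. Qed.

Lemma walk_cat B u p v q w :
  walk B u p v -> walk B v q w -> walk B u (p ++ q) w.
Proof.
elim: p u => [|e p IH] u /=; first by move->.
by move=> [Be eu pv] qw; split=> //; apply: IH.
Qed.

Lemma walk_split B u p q w :
  walk B u (p ++ q) w -> exists2 v, walk B u p v & walk B v q w.
Proof.
elim: p u => [|e p IH] u /=; first by move=> h; exists u.
by move=> [Be eu /IH [v pv qw]]; exists v.
Qed.

Lemma walk_sub B B' u p v : B `<=` B' -> walk B u p v -> walk B' u p v.
Proof.
move=> sBB'; elim: p u => [|e p IH] u //= [Be eu pv].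
by split; [exact: sBB'| |exact: IH].
Qed.

Lemma walk_edge B e : B e -> walk B (org e) [:: e] (tgt e).
Proof. by move=> Be /=. Qed.

Lemma walk_rev B u p v : (forall e, B e -> B (bar e)) ->
  walk B u p v -> walk B v (rev (map (@bar Y) p)) u.
Proof.
move=> barB; elim: p u => [|e p IH] u /=; first by move->.
move=> [Be <- /IH pv]; rewrite rev_cons -cats1; apply: (walk_cat pv).
by split; [exact: barB| |rewrite tgt_bar].
Qed.

Lemma walk_reduce B u p v :
  walk B u p v -> exists2 q, walk B u q v & reduced q.
Proof.
have [n] := ubnP (size p); elim: n p u => // n IH p u ltpn pv.
have [rp|/existsNP [p1 /existsNP [e /existsNP [p2 /contrapT Ep]]]] :=
  pselect (reduced p); first by exists p.
move: pv ltpn; rewrite Ep => /walk_split [x p1x [_ ex [_ _]]].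
rewrite tgt_bar ex => p2v; rewrite !size_cat /= => ltn.
apply: (IH (p1 ++ p2)); last exact: walk_cat p2v.
by rewrite size_cat; lia.
Qed.

Definition avoid e : set (edge Y) := [set a | a <> e /\ a <> bar e].

Lemma avoid_bar e a : avoid e a -> avoid e (bar a).
Proof.
move=> [ne nb]; split=> h; first by apply: nb; rewrite -h barK.
by apply: ne; rewrite -(barK a) h barK.
Qed.

Lemma avoid_of_bar e : avoid (bar e) = avoid e.
Proof. by rewrite /avoid barK; apply/seteqP; split=> a []. Qed.

Lemma avoidC e a : avoid e a -> avoid a e.
Proof. by move=> [ne nb]; split=> h; [apply: ne|apply: nb]; rewrite h ?barK. Qed.

(** In a tree, this is the half-tree at the origin of e of the complement of the
edge e. *)
Definition side e v := exists p, walk (avoid e) (org e) p v.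

Lemma side_org e : side e (org e).
Proof. by exists [::]. Qed.

Lemma side_walk e p u v : walk (avoid e) u p v -> side e u <-> side e v.
Proof.
move=> pv; split=> [[q qu]|[q qv]]; first by exists (q ++ p); exact: walk_cat pv.
exists (q ++ rev (map (@bar Y) p)); apply: walk_cat qv (walk_rev _ pv) => a.
exact: avoid_bar.
Qed.

Lemma side_edge e a : avoid e a -> side e (org a) <-> side e (tgt a).
Proof. by move=> ea; exact: side_walk (walk_edge ea). Qed.

(** The minimum is taken in the classical sense, so that the distance is a total
function on any graph; the default value 0 is taken for vertices that no walk
joins. *)
Definition dist u v : nat :=
  xget 0 [set n | (exists2 p, walk setT u p v & size p = n) /\
                  forall p, walk setT u p v -> n <= size p].

End Walks.

Section Trees.
Variable Y : graph.
Hypothesis tY : is_tree Y.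
Implicit Types (B : set (edge Y)) (u v w : vert Y) (e a : edge Y).

Lemma tree_connected u v : exists p, walk setT u p v.
Proof. by case: tY => _ /(_ u v I I). Qed.

(** A walk that joins the ends of e while avoiding e would close up, after
reduction, to a nontrivial reduced closed walk. *)
Lemma side_tgt e : ~ side e (tgt e).
Proof.
move=> [p /walk_reduce [q qt rq]].
case: tY => _ _ closed; suff: bar e :: q = [::] by [].
apply: (closed (tgt e)).
  by split=> //; rewrite tgt_bar; apply: walk_sub qt.
case=> [|c p1] a p2 /= [ea Eq]; last exact: (rq p1 a p2).
by move: qt; rewrite Eq -ea barK => -[[]].
Qed.

Lemma side_bar e v : side (bar e) v <-> ~ side e v.
Proof.
split=> [[p pv] sv|].
  move: pv; rewrite avoid_of_bar => /side_walk /iffRL /(_ sv).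
  exact: side_tgt.
have [p] := tree_connected (org e) v.
have : side e (org e) \/ side (bar e) (org e) by left; exact: side_org.
elim: p (org e) => [|a p IH] u su /=; first by move=> <- ns; case: su.
move=> [_ au /IH]; apply.
have [ea|/not_andP] := pselect (avoid e a).
  by move: su; rewrite -au (side_edge ea) (@side_edge _ (bar e) a) // avoid_of_bar.
case=> /contrapT ->; first by right; exact: side_org.
by left; rewrite tgt_bar; exact: side_org.
Qed.

Lemma side_barN e v : ~ side (bar e) v <-> side e v.
Proof. by rewrite side_bar; split=> [/contrapT //|sv]; apply. Qed.

Lemma dist_spec u v : (exists2 p, walk setT u p v & size p = dist u v) /\
                  forall p, walk setT u p v -> dist u v <= size p.
Proof.
have [p pv] := tree_connected u v.
pose P n := `[< exists2 p, walk setT u p v & size p = n >].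
have exP : exists n, P n by exists (size p); apply/asboolP; exists p.
pose Q := [set n | (exists2 p, walk setT u p v & size p = n) /\
                    forall p, walk setT u p v -> n <= size p].
suff : exists n, Q n by exact: xgetPex.
case: (ex_minnP exP) => m /asboolP Pm mP; exists m; split=> // q qv.
by apply: mP; apply/asboolP; exists q.
Qed.

Lemma dist_walk u v : exists2 p, walk setT u p v & size p = dist u v.
Proof. by case: (dist_spec u v). Qed.

Lemma dist_le u v p : walk setT u p v -> dist u v <= size p.
Proof. by case: (dist_spec u v) => _; apply. Qed.

Lemma distC u v : dist u v = dist v u.
Proof.
suff h (x y : vert Y) : dist x y <= dist y x by apply/eqP; rewrite eqn_leq !h.
have [p py <-] := dist_walk y x.
by have /dist_le := walk_rev (B := setT) (fun _ h => h) py; rewrite size_rev size_map.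
Qed.

Lemma dist_triangle v u w : dist u w <= dist u v + dist v w.
Proof.
have [p pv <-] := dist_walk u v; have [q qw <-] := dist_walk v w.
by rewrite -size_cat; apply: dist_le; exact: walk_cat qw.
Qed.

Lemma distvv u : dist u u = 0.
Proof. by apply/eqP; rewrite -leqn0; apply: (@dist_le u u [::]). Qed.

Lemma dist_edge e : dist (org e) (tgt e) <= 1.
Proof. exact: (@dist_le _ _ [:: e]). Qed.

Lemma walk_cross e p u v : walk setT u p v -> side e u -> ~ side e v ->
  exists p1 p2, p = p1 ++ e :: p2.
Proof.
elim: p u => [|a p IH] u /=; first by move->.
move=> [_ <- pv] su nsv.
have [<-|ae] := pselect (a = e); first by exists [::], p.
have ab : a <> bar e by move=> ab; move: su; rewrite ab; exact: side_tgt.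
have st : side e (tgt a) by rewrite -(side_edge (conj ae ab)).
by have [p1 [p2 ->]] := IH _ pv st nsv; exists (a :: p1), p2.
Qed.

(** Every walk from one half-tree to the other passes through the edge. *)
Lemma dist_cross e u v : side e u -> ~ side e v ->
  dist u v = dist u (org e) + (dist (tgt e) v).+1.
Proof.
move=> su sv; apply/eqP; rewrite eqn_leq; apply/andP; split; last first.
  have [p pv <-] := dist_walk u v.
  have [p1 [p2 Ep]] := walk_cross pv su sv; move: pv; rewrite Ep.
  move=> /walk_split [x p1x [_ xe p2v]]; rewrite size_cat /=.
  by rewrite -xe in p1x; rewrite leq_add // ?ltnS dist_le.
apply: leq_trans (dist_triangle (org e) _ _) _; rewrite leq_add2l.
by apply: leq_trans (dist_triangle (tgt e) _ _) _; rewrite -add1n leq_add2r dist_edge.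
Qed.

Lemma dist_cross_le e u v : ~ (side e u <-> side e v) ->
  dist u (org e) <= dist u v.
Proof.
have [su|nu] := pselect (side e u) => h.
  rewrite (@dist_cross e u v) ?leq_addr // => sv; exact: h.
have sv : side e v by apply: contrapT => nv; apply: h; split.
rewrite (distC u v) (@dist_cross e v u) // (distC u).
have := dist_triangle (tgt e) (org e) u; have := dist_edge e; lia.
Qed.

Lemma side_away e u : side e u -> dist u (tgt e) = (dist u (org e)).+1.
Proof. by move=> su; rewrite (dist_cross su (@side_tgt e)) distvv addn1. Qed.

(** The half-tree beyond a does not contain the edge b, so b does not separate
its vertices. *)
Lemma side_beyond a b w : avoid a b -> side a (org b) -> ~ side a w ->
  side b w <-> side b (tgt a).
Proof.
move=> ab sb nw; have [p] : side (bar a) w by apply/side_bar.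
rewrite avoid_of_bar => pw; apply: iff_sym; apply: (@side_walk _ _ p).
have : ~ side a (tgt a) := @side_tgt a.
move: pw; rewrite -/(tgt a); elim: p (tgt a) => [|c p IH] u //= [ac cu pw] nu.
have nc : ~ side a (tgt c) by rewrite -(side_edge ac) cu.
split=> //; last exact: IH.
split=> cb; apply: nu; rewrite -cu cb //.
by rewrite -/(tgt b) -(side_edge ab).
Qed.

(** Along a path without backtracking, the half-trees behind grow.  This is how
the local condition on geodesics becomes a global one. *)
Lemma side_nested e e' : tgt e = org e' -> e' <> bar e ->
  forall w, side e w -> side e' w.
Proof.
move=> te ne w sw.
have ne' : e' <> e.
  by move=> E; apply: (@side_tgt e); rewrite te E; exact: side_org.
have av : avoid (bar e) e' by rewrite avoid_of_bar.
have sb : side (bar e) (org e') by rewrite -te side_bar; exact: side_tgt.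
have nw : ~ side (bar e) w by exact: (side_barN e w).2.
rewrite (side_beyond av sb nw) tgt_bar.
have ea : avoid e' e by rewrite avoid_of_bar in av; exact: avoidC.
by rewrite (side_edge ea) te; exact: side_org.
Qed.

End Trees.

(** * Integer powers and infinite cyclic subgroups *)

Section IntegerPowers.
Local Open Scope group_scope.
Variable G : groupType.
Implicit Types (x y : G) (m n : int).

Definition zpow x n : G :=
  match n with Posz k => x ^+ k | Negz k => x ^- k.+1 end.

Lemma zpow0 x : zpow x 0 = 1. Proof. by []. Qed.

Lemma zpow1 x : zpow x 1 = x. Proof. by []. Qed.

Lemma zpowN1 x : zpow x (-1) = x^-1. Proof. by []. Qed.

Lemma PoszS (n : nat) : Posz n.+1 = (Posz n + 1)%R.
Proof. lia. Qed.

Lemma zpowS x n : zpow x (n + 1)%R = zpow x n * x.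
Proof.
case: n => [k|[|k]].
- by rewrite -PoszS; exact: expgSr.
- by have -> : (Negz 0 + 1)%R = 0%R by []; rewrite /= expg1 mulVg.
have -> : (Negz k.+1 + 1)%R = Negz k by lia.
by rewrite /= (expgS x k.+1) invgM mulgVK.
Qed.

Lemma zpowP x n : zpow x (n - 1)%R = zpow x n * x^-1.
Proof. by rewrite -{2}(subrK 1%R n) zpowS mulgK. Qed.

Lemma zpowD x m n : zpow x (m + n)%R = zpow x m * zpow x n.
Proof.
elim/int_rect: n => [|n IH|n IH]; first by rewrite addr0 zpow0 mulg1.
  by rewrite PoszS addrA !zpowS IH mulgA.
by rewrite PoszS opprD addrA !zpowP IH mulgA.
Qed.

Lemma zpowN x n : zpow x (- n)%R = (zpow x n)^-1.
Proof.
by apply: (mulgI (zpow x n)); rewrite -zpowD subrr mulgV.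
Qed.

Lemma zpowM x m n : zpow x (m * n)%R = zpow (zpow x m) n.
Proof.
elim/int_rect: n => [|n IH|n IH]; first by rewrite mulr0.
  by rewrite PoszS zpowS mulrDr mulr1 zpowD IH.
by rewrite PoszS opprD zpowP mulrDr mulrN1 zpowD IH (zpowN x m).
Qed.

Lemma zpow_conj x y n : zpow (y * x * y^-1) n = y * zpow x n * y^-1.
Proof.
elim/int_rect: n => [|n IH|n IH]; first by rewrite !zpow0 mulg1 mulgV.
  by rewrite PoszS !zpowS IH !mulgA mulgVK.
by rewrite PoszS opprD !zpowP IH !invgM invgK !mulgA mulgVK.
Qed.

Lemma infinite_cyclicP (H : set G) : infinite_cyclic H ->
  exists z, [/\ forall n, H (zpow z n), forall h, H h -> exists n, h = zpow z n
             & forall n, zpow z n = 1 -> n = 0%R].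
Proof.
move=> [phi [injp phiD rp]].
have phi0 : phi 0%R = 1.
  by apply: (mulgI (phi 0%R)); rewrite -phiD addr0 mulg1.
have phiN a : phi (- a)%R = (phi a)^-1.
  by apply: (mulgI (phi a)); rewrite -phiD subrr mulgV.
have E n : phi n = zpow (phi 1%R) n.
  elim/int_rect: n => [|n IH|n IH]; first by rewrite phi0.
    by rewrite PoszS zpowS phiD IH.
  by rewrite PoszS opprD phiD (phiN 1%R) zpowP IH.
exists (phi 1%R); split=> [n|h|n].
- by rewrite -E -rp; exists n.
- by rewrite -rp => -[n _ <-]; exists n; rewrite E.
- by rewrite -E -phi0 => /injp.
Qed.

End IntegerPowers.

(** * Lines in trees *)

Section Lines.
Local Open Scope ring_scope.
Variable Y : graph.
Hypothesis tY : is_tree Y.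
Implicit Types (l : int -> edge Y) (m n : int) (s : vert Y).

Definition line l :=
  forall n : int, tgt (l n) = org (l (n + 1)) /\ l (n + 1) <> bar (l n).

Lemma line_nested l m n s : line l -> m <= n -> side (l m) s -> side (l n) s.
Proof.
move=> ll mn sm; have [j ->] : exists j : nat, n = m + j%:Z.
  by exists `|n - m|%N; lia.
elim: j => [|j IH]; first by rewrite addr0.
have [te ne] := ll (m + j%:Z).
have -> : m + j.+1%:Z = m + j%:Z + 1 by lia.
exact: side_nested te ne _ IH.
Qed.

Lemma line_side l m n : line l -> side (l n) (org (l m)) <-> m <= n.
Proof.
move=> ll; split=> [sn|mn]; last exact: line_nested mn (side_org _).
rewrite leNgt; apply/negP => nm; apply: (side_tgt tY (e := l (m - 1))).
rewrite (ll (m - 1)).1 subrK; apply: line_nested sn => //; lia.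
Qed.

Lemma line_dist l m (j : nat) : line l -> dist (org (l m)) (org (l (m + j%:Z))) = j.
Proof.
move=> ll; elim: j => [|j IH]; first by rewrite addr0 distvv.
have -> : m + j.+1%:Z = m + j%:Z + 1 by lia.
rewrite -(ll _).1 side_away // ?IH //; apply/line_side => //; lia.
Qed.

Lemma line_org_inj l m n : line l -> org (l m) = org (l n) -> m = n.
Proof.
move=> ll E; have h1 := side_org (l m); have h2 := side_org (l n).
move: h1 h2; rewrite {1}E -{2}E => /line_side h1 /line_side h2.
by apply: le_anti; rewrite h1 ?h2.
Qed.

Lemma line_bar l m n : line l -> l m <> bar (l n).
Proof.
move=> ll E; have := congr1 (@org Y) E; rewrite -/(tgt (l n)) (ll n).1.
have := congr1 (@tgt Y) E; rewrite tgt_bar (ll m).1.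
move=> /(line_org_inj ll) h1 /(line_org_inj ll); lia.
Qed.

(** An edge l n that separates s from the origin of l 0 lies on the geodesic
between these two vertices, so |n| is bounded by their distance. *)
Lemma line_sides l s : line l -> exists j : nat, forall n,
  (j%:Z <= n -> side (l n) s) /\ (n <= - j%:Z -> ~ side (l n) s).
Proof.
move=> ll; exists (dist (org (l 0)) s).+1 => n; split=> [jn|nj sn].
  apply: contrapT => ns.
  have s0 : side (l n) (org (l 0)) by apply/line_side => //; lia.
  have := dist_cross tY s0 ns; have := line_dist 0 (absz n) ll.
  have -> : 0 + (absz n)%:Z = n by lia.
  lia.
have s0 : ~ side (l n) (org (l 0)) by move/(line_side _ _ ll); lia.
have := dist_cross tY sn s0; have := line_dist (n + 1) (absz (n + 1)%R) ll.
have -> : n + 1 + (absz (n + 1)%R)%:Z = 0 by lia.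
rewrite (ll n).1 (distC tY s (org (l 0))); lia.
Qed.

End Lines.

(** * Groups acting on trees and axes *)

Section Actions.
Local Open Scope group_scope.
Variables (G : groupType) (T : Ggraph G).
Implicit Types (g h x : G) (u v w : vert T) (e a : edge T).

Lemma vactVK h : cancel (@vact G T h^-1) (vact h).
Proof. by move=> v; rewrite -vactM mulgV vact1. Qed.

Lemma eactVK h : cancel (@eact G T h^-1) (eact h).
Proof. by move=> e; rewrite -eactM mulgV eact1. Qed.

Lemma eact_inj h : injective (@eact G T h).
Proof. exact: can_inj (eactK h). Qed.

Lemma eact_tgt h e : tgt (eact h e) = vact h (tgt e).
Proof. by rewrite /tgt eact_bar eact_org. Qed.

Lemma walk_image (B B' : set (edge T)) h u p v :
  (forall e, B e -> B' (eact h e)) -> walk B u p v ->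
  walk B' (vact h u) (map (eact h) p) (vact h v).
Proof.
move=> BB'; elim: p u => [|e p IH] u /=; first by move->.
move=> [Be <- /IH pv]; rewrite eact_tgt eact_org; split=> //; exact: BB'.
Qed.

Lemma avoid_act h e a : avoid e a -> avoid (eact h e) (eact h a).
Proof. by rewrite /avoid /= eact_bar => -[ne nb]; split=> /eact_inj. Qed.

Lemma side_act h e v : side (eact h e) (vact h v) <-> side e v.
Proof.
suff imp k a w : side a w -> side (eact k a) (vact k w).
  split; last exact: imp.
  by move=> /(imp h^-1); rewrite eactK vactK.
move=> [p pw]; exists (map (eact k) p); rewrite eact_org.
by apply: walk_image pw => b; exact: avoid_act.
Qed.

Lemma side_actl h e v : side (eact h e) v <-> side e (vact h^-1 v).
Proof. by rewrite -{1}(vactVK h v) side_act. Qed.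

Lemma side_actr h e v : side e (vact h v) <-> side (eact h^-1 e) v.
Proof. by rewrite side_actl invgK. Qed.

Hypothesis tT : is_tree T.

Lemma dist_act h u v : dist (vact h u) (vact h v) = dist u v.
Proof.
suff le k (a b : vert T) : dist (vact k a) (vact k b) <= dist a b.
  apply/eqP; rewrite eqn_leq le /=.
  by have := le h^-1 (vact h u) (vact h v); rewrite !vactK.
have [p pb <-] := dist_walk tT a b.
by rewrite -(size_map (eact k) p); apply: (dist_le tT); apply: walk_image pb.
Qed.

Lemma axis_line_zpow g l : axis_line (T := T) g l ->
  exists2 k : int, (0 < k)%R & forall j n, eact (zpow g j) (l n) = l (n + k * j)%R.
Proof.
move=> [_ [k k0 gl]]; exists k => // j.
elim/int_rect: j => [|j IH|j IH] n; first by rewrite mulr0 addr0 zpow0 eact1.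
  by rewrite PoszS zpowS eactM gl IH mulrDr mulr1 (addrC (k * j)%R) addrA.
rewrite PoszS opprD zpowP eactM; have -> : eact g^-1 (l n) = l (n - k)%R.
  by rewrite -{1}(subrK k n) -gl eactK.
by rewrite IH mulrDr mulrN1 (addrC (k * _)%R) addrA.
Qed.

Lemma axis_line_line g l : axis_line (T := T) g l -> line l.
Proof. by case. Qed.

(** On its axis, the j-th power of g moves a vertex by k |j| for some k > 0;
everywhere else the displacement differs from this by a bounded amount. *)
Lemma axis_escape g l (z z' : vert T) (M : nat) : axis_line (T := T) g l ->
  exists j0 : nat, forall j : int, j0 <= `|j|%N -> M < dist z (vact (zpow g j) z').
Proof.
move=> al; have ll := axis_line_line al; have [k k0 gl] := axis_line_zpow al.
pose o := org (l 0%R).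
exists (M + dist o z + dist z' o).+1 => j jj.
have h1 : `|j|%N <= dist o (vact (zpow g j) o).
  rewrite -eact_org gl add0r.
  case: (lerP 0%R j) => j0.
    have := line_dist tT 0%R `|(k * j)%R|%N ll; rewrite add0r.
    have -> : Posz `|(k * j)%R|%N = (k * j)%R by nia.
    by move=> ->; nia.
  have := line_dist tT (k * j)%R `|(k * j)%R|%N ll.
  have -> : (k * j + Posz `|(k * j)%R|%N)%R = 0%R by nia.
  by rewrite (distC tT) => ->; nia.
have h2 := dist_triangle tT z o (vact (zpow g j) o).
have h3 := dist_triangle tT (vact (zpow g j) z') z (vact (zpow g j) o).
rewrite dist_act in h3; lia.
Qed.

Lemma walk_nth_dist u p v a i : walk setT u p v -> i < size p ->
  (dist u (org (nth a p i)) <= i) /\ (dist (tgt (nth a p i)) v < size p - i).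
Proof.
move=> pv ip; move: pv; rewrite -{1}(cat_take_drop i p) (drop_nth a ip).
move=> /walk_split [x px [_ xe qv]]; rewrite -xe in px; split.
  by have := dist_le tT px; rewrite size_takel // ltnW.
have := dist_le tT qv; rewrite size_drop; lia.
Qed.

Lemma walk_nth B u p v a : walk B u p v ->
  (forall i, i.+1 < size p -> tgt (nth a p i) = org (nth a p i.+1)).
Proof.
elim: p u => [|e p IH] u //= [_ _ pv] [|i] ip; last exact: (IH _ pv).
by case: p ip pv {IH} => //= b p _ [_ <-].
Qed.

Lemma walk_last B u p v a : walk B u p v -> p <> [::] -> tgt (last a p) = v.
Proof.
elim/last_ind: p => // p b _ + _; rewrite last_rcons -cats1.
by move=> /walk_split [x _ [_ _]].
Qed.

(** Let v be a vertex that g moves the least, and p a geodesic from v to g v.  The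
translates of p by powers of g form a line: a backtracking at g v would give a
vertex with smaller displacement, or an inversion if p is a single edge. *)
Lemma axis_exists g : (forall (h : G) (e : edge T), eact h e <> bar e) ->
  (forall v, vact g v <> v) -> exists l, axis_line (T := T) g l.
Proof.
move=> noinv nofix; have [[v0 _] _ _] := tT.
pose P n := `[< exists v, dist v (vact g v) = n >].
have exP : exists n, P n by exists (dist v0 (vact g v0)); apply/asboolP; exists v0.
case: (ex_minnP exP) => k /asboolP [v dv] kmin.
have {}kmin w : k <= dist w (vact g w) by apply: kmin; apply/asboolP; exists w.
have [p pv sp] := dist_walk tT v (vact g v).
have pn : p <> [::] by move=> p0; move: pv; rewrite p0 /= => E; apply: (nofix v).
case Ep: p pn => [//|a p'] _.
have k0 : 0 < k by rewrite -dv -sp Ep.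
have {}sp : size p = k by rewrite sp.
pose l (n : int) := eact (zpow g (n %/ k)%Z) (nth a p `|(n %% k)%Z|%N).
have lE (q : int) (r : nat) : r < k -> l (q * k + r)%R = eact (zpow g q) (nth a p r).
  move=> rk; rewrite /l divzMDl; last by lia.
  by rewrite modzMDl divz_small ?addr0 ?modz_small //; lia.
have nz : Posz k != 0%R by lia.
have org0 : org (nth a p 0) = v by move: pv; rewrite Ep /= => -[].
have tlast : tgt (nth a p k.-1) = vact g v.
  by rewrite -sp nth_last (walk_last _ pv) // Ep.
have dec (n : int) : exists (q : int) (r : nat), r < k /\ n = (q * k + r)%R.
  have := ltz_mod n nz; have := modz_ge0 n nz => h1 h2.
  exists (n %/ k)%Z, `|(n %% k)%Z|%N; split; first by lia.
  by rewrite {1}(divz_eq n k); lia.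
exists l; split=> [n|]; last first.
  exists (Posz k) => // n; have [q [r [rk ->]]] := dec n.
  have -> : (q * k + r + k = (q + 1) * k + r)%R by lia.
  by rewrite !lE // -eactM addrC zpowD.
have [q [r [rk ->]]] := dec n; rewrite lE // -addrA -PoszS.
have [rk1|kr] := ltnP r.+1 k.
  rewrite lE //; split.
    by rewrite eact_tgt eact_org (walk_nth a pv) // sp.
  rewrite eact_bar => /eact_inj E.
  have := walk_nth_dist a pv (i := r); have := walk_nth_dist a pv (i := r.+1).
  rewrite E tgt_bar sp => /(_ rk1) [_ h2] /(_ rk) [h1 _].
  have := dist_triangle tT (org (nth a p r)) v (vact g v); lia.
have Er : r = k.-1 by lia.
have -> : (q * k + r.+1)%R = ((q + 1) * k + 0%N)%R by lia.
rewrite lE // zpowS eactM Er.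
split; first by rewrite eact_tgt !eact_org tlast org0.
rewrite eact_bar => /eact_inj E.
have [k1|k1] := ltnP k 2.
  have k10 : k.-1 = 0 by lia.
  by rewrite k10 in E; exact: noinv E.
have := kmin (tgt (nth a p 0)); rewrite -eact_tgt E tgt_bar Ep.
move: pv sp; rewrite Ep => -[_ _ p'v] /= sp.
case Ek : (k.-1) k1 => [|i] k1; first by lia.
have ip : i < size p' by lia.
have := (walk_nth_dist a p'v ip).1; rewrite /=; lia.
Qed.

End Actions.

(** * Recognizing the elementary groups *)

Section Recognition.
Local Open Scope group_scope.

Section WordEq.
Variables (X : Type) (R : set (word X)).

Lemma word_eq_catl w u v : word_eq R u v -> word_eq R (w ++ u) (w ++ v).
Proof.
elim=> [u'|u' v' _ IH|u' v' w' _ IH1 _ IH2|u' x b v'|u' r v' Rr].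
- exact: word_eq_refl.
- exact: word_eq_sym.
- exact: word_eq_trans IH1 IH2.
- by rewrite catA (catA w u' v'); exact: word_eq_cancel.
- by rewrite catA (catA w u' v'); exact: word_eq_relator.
Qed.

Lemma word_eq_catr w u v : word_eq R u v -> word_eq R (u ++ w) (v ++ w).
Proof.
elim=> [u'|u' v' _ IH|u' v' w' _ IH1 _ IH2|u' x b v'|u' r v' Rr].
- exact: word_eq_refl.
- exact: word_eq_sym.
- exact: word_eq_trans IH1 IH2.
- by rewrite -!catA; exact: word_eq_cancel.
- by rewrite -!catA; exact: word_eq_relator.
Qed.

Lemma word_eq_cancelV u x b v :
  word_eq R (u ++ [:: (x, ~~ b); (x, b)] ++ v) (u ++ v).
Proof. by rewrite -{2}(negbK b); exact: word_eq_cancel. Qed.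

Definition power_word (x : X) (n : int) : word X :=
  match n with Posz k => nseq k (x, false) | Negz k => nseq k.+1 (x, true) end.

Lemma power_word_cons x b n :
  word_eq R ((x, b) :: power_word x n) (power_word x (n + (if b then -1 else 1)))%R.
Proof.
case: b; case: n => [[|n]|n].
- exact: word_eq_refl.
- have -> : (Posz n.+1 + -1)%R = Posz n by lia.
  exact: (@word_eq_cancel _ R [::] x true).
- have -> : (Negz n + -1)%R = Negz n.+1 by lia.
  exact: word_eq_refl.
- exact: word_eq_refl.
- have -> : (Posz n.+1 + 1)%R = Posz n.+2 by lia.
  exact: word_eq_refl.
- case: n => [|n]; first exact: (@word_eq_cancel _ R [::] x false).
  have -> : (Negz n.+1 + 1)%R = Negz n by lia.
  exact: (@word_eq_cancel _ R [::] x false).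
Qed.

Lemma word_val_cat (G : groupType) (f : X -> G) u v :
  word_val f (u ++ v) = word_val f u * word_val f v.
Proof. by elim: u => [|a u IH] /=; rewrite ?mul1g // IH mulgA. Qed.

Lemma word_val_power (G : groupType) (f : X -> G) x n :
  word_val f (power_word x n) = zpow (f x) n.
Proof.
case: n => n /=.
  by elim: n => [|n IH] //=; rewrite IH expgS.
rewrite -expVgn expgS; congr (_ * _).
by elim: n => [|n IH] //=; rewrite IH expgS.
Qed.

End WordEq.

Section Klein.
Let R : set (word bool) :=
  [set [:: (true, false); (false, false); (true, true); (false, false)]].

Local Notation tw b := (true, b).
Local Notation aw c := (false, c).

(* t a = a^-1 t, and hence t^b a^c = a^-c t^b for all signs b and c *)
Let swap b c : word_eq R [:: tw b; aw c] [:: aw (~~ c); tw b].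
Proof.
have flip_c b' c' : word_eq R [:: tw b'; aw c'] [:: aw (~~ c'); tw b'] ->
    word_eq R [:: tw b'; aw (~~ c')] [:: aw c'; tw b'].
  move=> C.
  apply: word_eq_trans (word_eq_sym
    (word_eq_cancel R [::] false c' [:: tw b'; aw (~~ c')])) _.
  apply: word_eq_trans (word_eq_catl [:: aw c']
    (word_eq_catr [:: aw (~~ c')] (word_eq_sym C))) _.
  exact: (word_eq_cancel R [:: aw c'; tw b'] false c' [::]).
have flip_b b' c' : word_eq R [:: tw b'; aw c'] [:: aw (~~ c'); tw b'] ->
    word_eq R [:: tw (~~ b'); aw (~~ c')] [:: aw c'; tw (~~ b')].
  move=> C.
  apply: word_eq_trans (word_eq_sym
    (word_eq_cancel R [:: tw (~~ b'); aw (~~ c')] true b' [::])) _.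
  apply: word_eq_trans (word_eq_catl [:: tw (~~ b')]
    (word_eq_catr [:: tw (~~ b')] (word_eq_sym C))) _.
  exact: (word_eq_cancelV R [::] true b').
have C00 : word_eq R [:: tw false; aw false] [:: aw true; tw false].
  (* insert t^-1 t and then a a^-1 to make the relator appear *)
  apply: word_eq_trans (word_eq_sym
    (word_eq_cancelV R [:: tw false; aw false] true false [::])) _.
  apply: word_eq_trans (word_eq_sym (word_eq_cancel R
    [:: tw false; aw false; tw true] false false [:: tw false])) _.
  exact: (@word_eq_relator _ R [::] [:: tw false; aw false; tw true; aw false]
    [:: aw true; tw false]).
have C01 := flip_c _ _ C00.
have C10 := flip_b _ _ C01.
have C11 := flip_c _ _ C10.
by case: b; case: c.
Qed.

Let swap_power b n : word_eq R ((true, b) :: power_word false n)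
  (power_word false (- n) ++ [:: (true, b)]).
Proof.
have swap_nseq c k : word_eq R ((true, b) :: nseq k (false, c))
    (nseq k (false, ~~ c) ++ [:: (true, b)]).
  elim: k => [|k IH] /=; first exact: word_eq_refl.
  apply: (word_eq_trans (word_eq_catr (nseq k (false, c)) (swap b c))).
  exact: (word_eq_catl [:: (false, ~~ c)] IH).
case: n => [[|n]|n]; first exact: word_eq_refl.
  exact: (swap_nseq false n.+1).
exact: (swap_nseq true n.+1).
Qed.

(** In the presented group every word equals a word a^i t^j, as letters t can be
moved to the right across powers of a; such a word is trivial in G only if
i = j = 0. *)
Lemma klein_bottleP (G : groupType) (a t : G) :
  t * a * t^-1 = a^-1 ->
  (forall x, exists i j, x = zpow a i * zpow t j) ->
  (forall i j, zpow a i * zpow t j = 1 -> i = 0%R /\ j = 0%R) ->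
  klein_bottle_group G.
Proof.
move=> tat gen free; pose f (b : bool) := if b then t else a.
have fR r : R r -> word_val f r = 1.
  by move=> ->; rewrite /= mulg1 !mulgA tat mulVg.
have sound u v : word_eq R u v -> word_val f u = word_val f v.
  elim=> [||u' v' w' _ -> _ ->|u' x b v'|u' r v' /fR r1] //.
    rewrite !word_val_cat; congr (_ * _); case: b => /=.
      by rewrite mulg1 mulVg mul1g.
    by rewrite mulg1 mulgV mul1g.
  by rewrite !word_val_cat r1 mul1g.
have normal w : exists i j, word_eq R w (power_word false i ++ power_word true j).
  elim: w => [|[x b] w [i [j IH]]]; first by exists 0%R, 0%R; exact: word_eq_refl.
  have {}IH := word_eq_catl [:: (x, b)] IH.
  case: x IH => IH; last first.
    exists (i + (if b then -1 else 1))%R, j; apply: (word_eq_trans IH).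
    exact: (word_eq_catr _ (power_word_cons R false b i)).
  exists (- i)%R, (j + (if b then -1 else 1))%R; apply: (word_eq_trans IH).
  apply: (word_eq_trans (word_eq_catr _ (swap_power b i))).
  by rewrite -catA; apply: word_eq_catl; exact: power_word_cons.
exists f; split=> [x|w].
  have [i [j ->]] := gen x; exists (power_word false i ++ power_word true j).
  by rewrite word_val_cat !word_val_power.
split=> [w1|/sound //].
have [i [j wij]] := normal w; have := sound _ _ wij.
rewrite w1 word_val_cat !word_val_power => /esym/free [i0 j0].
by move: wij; rewrite i0 j0.
Qed.

End Klein.

Lemma Z2P (G : groupType) (a t : G) :
  t * a * t^-1 = a ->
  (forall x, exists i j, x = zpow a i * zpow t j) ->
  (forall i j, zpow a i * zpow t j = 1 -> i = 0%R /\ j = 0%R) ->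
  iso_subgroup (int * int)%type [set: G].
Proof.
move=> tat gen free.
have ta : t * a = a * t by rewrite -[in RHS]tat mulgVK.
have tja j : zpow t j * a = a * zpow t j.
  elim/int_rect: j => [|j IH|j IH]; first by rewrite zpow0 mul1g mulg1.
    by rewrite PoszS zpowS -mulgA ta mulgA IH mulgA.
  have tV : t^-1 * a = a * t^-1 by rewrite -{1}tat !mulgA mulVg mul1g.
  by rewrite PoszS opprD zpowP -mulgA tV mulgA IH mulgA.
have com i j : zpow t j * zpow a i = zpow a i * zpow t j.
  have := zpow_conj a (zpow t j) i; rewrite tja mulgK => E.
  by rewrite {2}E mulgVK.
pose phi (p : (int * int)%type) := zpow a p.1 * zpow t p.2.
have phiD p q : phi (p + q)%R = phi p * phi q.
  rewrite /phi /= !zpowD !mulgA; congr (_ * _).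
  by rewrite -!mulgA; congr (_ * _); rewrite com.
exists phi; split=> //; last first.
  by apply/seteqP; split=> // x _; have [i [j ->]] := gen x; exists (i, j).
move=> p q pq; apply/eqP; rewrite -subr_eq0; apply/eqP.
have : phi (p - q)%R = 1.
  by apply: (mulIg (phi q)); rewrite mul1g -[RHS]pq -phiD subrK.
by rewrite /phi => /free; case: (p - q)%R => i j /= [-> ->].
Qed.

End Recognition.

(** * Groups acting on a line *)

Section LineAction.
Local Open Scope group_scope.
Variables (G : groupType) (S : Ggraph G).
Hypothesis SD : cyclic_deformation_space S.
Variable l : int -> edge S.
Hypothesis ll : line l.
Hypothesis allE : forall e, exists n, e = l n \/ e = bar (l n).
Implicit Types (h x y : G) (m n : int).

Let tS : is_tree S. Proof. by case: SD => -[]. Qed.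

Definition shifts h m := forall n, eact h (l n) = l (n + m)%R.
Definition flips h m := forall n, eact h (l n) = bar (l (m - n)%R).

Let next e p : org e = tgt (l p) -> e <> bar (l p) -> e = l (p + 1)%R.
Proof.
have [n [->|->]] := allE e; rewrite (ll p).1.
  by move=> /(line_org_inj tS ll) ->.
by rewrite -/(tgt (l n)) (ll n).1 => /(line_org_inj tS ll) /addIr ->.
Qed.

Let prev e p : org e = org (l p) -> e <> l p -> e = bar (l (p - 1)%R).
Proof.
have [n [->|->]] := allE e.
  by move=> /(line_org_inj tS ll) ->.
rewrite -/(tgt (l n)) (ll n).1 => /(line_org_inj tS ll) <- _.
by rewrite addrK.
Qed.

Lemma shifts_or_flips h : (exists m, shifts h m) \/ (exists m, flips h m).
Proof.
have ne n : eact h (l (n + 1)%R) <> bar (eact h (l n)).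
  by rewrite eact_bar => /eact_inj; exact: (ll n).2.
have oe n : org (eact h (l (n + 1)%R)) = tgt (eact h (l n)).
  by rewrite eact_tgt eact_org (ll n).1.
have [m [h0|h0]] := allE (eact h (l 0%R)).
  left; exists m; elim/int_rect => [|n IH|n IH]; first by rewrite h0 add0r.
    rewrite PoszS; have -> : (n%:Z + 1 + m = n%:Z + m + 1)%R by lia.
    by apply: next; rewrite -IH; [exact: oe|exact: ne].
  rewrite PoszS opprD; have -> : (- n%:Z - 1 + m = - n%:Z + m - 1)%R by lia.
  have on := oe (- n%:Z - 1)%R; have nn := ne (- n%:Z - 1)%R.
  rewrite subrK in on nn; apply: (can_inj (@barK S)).
  by apply: prev; rewrite -IH // => E; apply: nn; rewrite E.
right; exists m; elim/int_rect => [|n IH|n IH]; first by rewrite h0 subr0.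
  rewrite PoszS opprD addrA; apply: prev; rewrite ?oe ?IH ?tgt_bar //.
  by move=> E; apply: (ne n); rewrite E IH barK.
rewrite PoszS opprD; have -> : (m - (- n%:Z - 1) = m - - n%:Z + 1)%R by lia.
have on := oe (- n%:Z - 1)%R; have nn := ne (- n%:Z - 1)%R.
rewrite subrK IH in on nn; apply: (can_inj (@barK S)); rewrite barK.
by apply: next; [rewrite -/(tgt _) -on|move=> E; apply: nn; rewrite E].
Qed.

Lemma shifts_uniq h m m' : shifts h m -> shifts h m' -> m = m'.
Proof.
move=> /(_ 0%R) E /(_ 0%R); rewrite E !add0r => /(congr1 (@org S)).
by move=> /(line_org_inj tS ll).
Qed.

Lemma shifts_flips h m m' : shifts h m -> flips h m' -> False.
Proof. by move=> /(_ 0%R) E /(_ 0%R); rewrite E => /(line_bar tS ll). Qed.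

Lemma shifts1 : shifts 1 0.
Proof. by move=> n; rewrite eact1 addr0. Qed.

Lemma shiftsM h h' m m' : shifts h m -> shifts h' m' -> shifts (h * h') (m + m')%R.
Proof. by move=> hm hm' n; rewrite eactM hm' hm -addrA (addrC m). Qed.

Lemma shiftsV h m : shifts h m -> shifts h^-1 (- m)%R.
Proof. by move=> hm n; rewrite -{1}(subrK m n) -hm eactK. Qed.

Lemma shifts_zpow h m j : shifts h m -> shifts (zpow h j) (m * j)%R.
Proof.
move=> hm; elim/int_rect: j => [|j IH|j IH].
- by rewrite mulr0; exact: shifts1.
- by rewrite PoszS zpowS mulrDr mulr1; exact: shiftsM.
- by rewrite PoszS opprD zpowP mulrDr mulrN1; apply: shiftsM => //; exact: shiftsV.
Qed.

Lemma flips_flips h h' m m' : flips h m -> flips h' m' -> shifts (h * h') (m - m')%R.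
Proof.
move=> hm hm' n; rewrite eactM hm' -eact_bar hm barK; congr (l _); lia.
Qed.

Lemma shifts_flipsM h h' m m' :
  shifts h m -> flips h' m' -> flips (h * h') (m + m')%R.
Proof.
move=> hm hm' n; rewrite eactM hm' -eact_bar hm; congr (bar (l _)); lia.
Qed.

Lemma flipsV h m : flips h m -> flips h^-1 m.
Proof.
move=> hm n; apply: (eact_inj (h := h)); rewrite eactVK -eact_bar hm barK.
by congr (l _); lia.
Qed.

Let stabE h : estab (l 0%R) h <-> shifts h 0.
Proof.
split=> [h0|/(_ 0%R)]; last by rewrite addr0.
have [[m hm]|[m hm]] := shifts_or_flips h.
  have := hm 0%R; rewrite h0 add0r => /(congr1 (@org S)) /(line_org_inj tS ll) E.
  by rewrite -E in hm.
by have := hm 0%R; rewrite h0 => /(line_bar tS ll).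
Qed.

(** A flip fixes a vertex since it does not invert an edge.  It is an odd power of
a generator y of the stabilizer of this vertex, and y is a flip about the same
vertex; the pointwise stabilizer of the line consists of the even powers of y. *)
Lemma flips_root h m : flips h m -> exists y,
  [/\ flips y m, forall u, shifts u 0 -> exists i, u = zpow y (2 * i)%R
    & forall n, zpow y n = 1 -> n = 0%R].
Proof.
move=> hm; have [[_ noinv _] vc _] := SD.
have [n Em] : exists n, m = (2 * n + 1)%R.
  exists (m %/ 2)%Z; suff : (m %% 2)%Z <> 0%R by lia.
  move=> m0; apply: (noinv h (l (m %/ 2)%Z)); rewrite hm; congr (bar (l _)); lia.
pose v := org (l (n + 1)%R).
have fix_flip k : flips k m -> vact k v = v.
  by move=> km; rewrite -eact_org km -/(tgt _) (ll _).1; congr (org (l _)); lia.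
have [y [yv vy yinf]] := infinite_cyclicP (vc v).
have shift0 k m' : shifts k m' -> vact k v = v -> m' = 0%R.
  by move=> km; rewrite -eact_org km => /(line_org_inj tS ll); lia.
have [c hc] := vy h (fix_flip _ hm).
have yv1 : vact y v = v := yv 1%R.
have ym : flips y m.
  have [[m' ym']|[m' ym']] := shifts_or_flips y.
    have m0 := shift0 _ _ ym' yv1; rewrite m0 in ym'.
    have := shifts_zpow c ym'; rewrite mul0r -hc => h0.
    by case: (shifts_flips h0 hm).
  suff <- : m' = m by [].
  move: yv1; rewrite -eact_org ym' -/(tgt _) (ll _).1.
  by move=> /(line_org_inj tS ll); lia.
exists y; split=> // u u0.
have uv : vact u v = v by rewrite -eact_org u0 addr0.
have [d ud] := vy u uv; exists (d %/ 2)%Z; rewrite ud; congr zpow.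
suff : (d %% 2)%Z <> 1%R by lia.
move=> d1; have y2 : shifts (zpow (y * y) (d %/ 2)%Z) 0.
  by have := shifts_zpow (d %/ 2)%Z (flips_flips ym ym); rewrite subrr mul0r.
apply: (shifts_flips u0 (m' := (0 + m)%R)); rewrite ud.
have -> : d = ((1 + 1) * (d %/ 2)%Z + 1)%R by lia.
by rewrite zpowS zpowM (zpowS y 1) zpow1; exact: shifts_flipsM.
Qed.

Variables (z : G) (kz : int).
Hypotheses (kz0 : (0 < kz)%R) (zk : shifts z kz).

(** The last clause is stated for every t with the minimal shift length k, since
in the presence of flips a better choice than tau has to be made. *)
Lemma minimal_shift : exists (tau : G) (k : nat), [/\ 0 < k, shifts tau k
  & forall t, shifts t k -> forall h m, shifts h m ->
      exists q u, h = zpow t q * u /\ shifts u 0].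
Proof.
pose P (n : nat) := `[< 0 < n /\ exists h, shifts h n%:Z >].
have exP : exists n : nat, P n.
  exists `|kz|%N; apply/asboolP; split; first by lia.
  by exists z; have -> : Posz `|kz|%N = kz by lia.
case: (ex_minnP exP) => k /asboolP [k0 [tau tauk]] kmin.
exists tau, k; split=> // t tk h m hm.
exists (m %/ k)%Z, ((zpow t (m %/ k)%Z)^-1 * h); split; first by rewrite mulVKg.
have := shiftsM (shiftsV (shifts_zpow (m %/ k)%Z tk)) hm.
have knz : Posz k != 0%R by lia.
have -> : (- (k%:Z * (m %/ k)%Z) + m = (m %% k)%Z)%R by have := divz_eq m k; lia.
have m0 := modz_ge0 m knz; have mk := ltz_mod m knz => hu.
suff -> : 0%R = (m %% k)%Z by [].
apply: contrapT => mn; suff : k <= `|(m %% k)%Z|%N by lia.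
apply: kmin; apply/asboolP; split; first by lia.
exists ((zpow t (m %/ k)%Z)^-1 * h).
by have -> : Posz `|(m %% k)%Z|%N = (m %% k)%Z by lia.
Qed.

Lemma mulz_eq1_unit (i j : int) : (i * j = 1)%R -> i = 1%R \/ i = (-1)%R.
Proof.
move=> /(congr1 absz); rewrite abszM => /eqP; rewrite muln_eq1 => /andP[/eqP]; lia.
Qed.

(** Let b generate the pointwise stabilizer of the line.  Without flips, G is the
semidirect product of <b> by a minimal shift tau, which maps b to b or b^-1.
With flips, let x and y generate the stabilizers of two adjacent vertices fixed
by flips: x^2 and y^2 both generate <b>, so x^2 = y^2 after inverting y if
necessary, and G is the Klein bottle group with a = y x^-1 and t = x. *)
Lemma line_elementary : elementary G.
Proof.
have [[_ noinv _] _ ec] := SD.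
have [tau [k [k0 tauk dec]]] := minimal_shift.
have [b [bN Nb binf]] := infinite_cyclicP (ec (l 0%R)).
have [[x0 [m x0m]]|noflip] := pselect (exists x m, flips x m).
  have [x [xm Nx xinf]] := flips_root x0m.
  have [y [ym Ny yinf]] := flips_root (shifts_flipsM tauk xm).
  (* y * y = (x * x)^j with j = 1 or -1; if j = -1, then y^-1 is taken *)
  have {y ym Ny yinf} [y ym y2x] : exists2 y, flips y (k%:Z + m)%R & y * y = x * x.
    have sq w : zpow w 2 = w * w by rewrite (zpowS w 1).
    have x20 : shifts (x * x) 0 by rewrite -(subrr m); exact: flips_flips.
    have y20 : shifts (y * y) 0 by rewrite -(subrr (k%:Z + m)%R); exact: flips_flips.
    have [i xi] := Ny _ x20; have [j yj] := Nx _ y20.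
    move: (xi) (yj); rewrite !zpowM !sq => xi' yj'.
    have : (j * i = 1)%R.
      suff : (2 * (j * i - 1) = 0)%R by lia.
      apply: xinf; rewrite zpowM zpowP zpowM sq -yj' -xi' mulgV //.
    case/mulz_eq1_unit => E; move: yj'; rewrite E ?zpow1 ?zpowN1 => yj'.
      by exists y.
    by exists y^-1; [exact: flipsV|rewrite -invgM yj' invgK].
  apply: Or33; pose a := y * x^-1.
  have ak : shifts a k.
    have -> : Posz k = (k%:Z + m - m)%R by lia.
    by apply: flips_flips => //; exact: flipsV.
  have shiftE u : shifts u 0 -> exists i, u = zpow x i.
    by move=> /Nx [i ->]; exists (2 * i)%R.
  apply: (@klein_bottleP G a x).
  - rewrite /a invgM invgK -!mulgA; congr (x * _).
    by rewrite -invgM -y2x invgM mulVKg.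
  - move=> h; have [[m' hm']|[m' hm']] := shifts_or_flips h.
      have [q [u [-> /shiftE [i ->]]]] := dec a ak h m' hm'.
      by exists q, i.
    have [q [u [E /shiftE [i ui]]]] := dec a ak _ _ (flips_flips hm' (flipsV xm)).
    by exists q, (i + 1)%R; rewrite zpowS mulgA -ui -E mulgVK.
  - move=> i j ij1; have xx0 : shifts (x * x) 0.
      by rewrite -(subrr m); exact: flips_flips.
    have xe : shifts (zpow (x * x) (j %/ 2)%Z) 0.
      by have := shifts_zpow (j %/ 2)%Z xx0; rewrite mul0r.
    have je : j = ((1 + 1) * (j %/ 2)%Z)%R.
      suff : (j %% 2)%Z <> 1%R by lia.
      move=> j1; have := shifts1; rewrite -ij1 => /shifts_flips; apply.
        apply: shifts_flipsM (shifts_zpow i ak) _.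
      have -> : j = ((1 + 1) * (j %/ 2)%Z + 1)%R by lia.
      by rewrite zpowS zpowM (zpowS x 1) zpow1; exact: shifts_flipsM xe xm.
    have i0 : i = 0%R.
      have := shiftsM (shifts_zpow i ak) xe.
      have -> : x * x = zpow x (1 + 1)%R by rewrite zpowS.
      by rewrite -zpowM -je ij1 => /(shifts_uniq shifts1); nia.
    by move: ij1; rewrite i0 zpow0 mul1g => /xinf.
have tr h : exists m', shifts h m'.
  by case: (shifts_or_flips h) => // -[m' hm']; case: noflip; exists h, m'.
have shiftE u : shifts u 0 -> exists i, u = zpow b i by move/stabE/Nb.
have b0 : shifts b 0 by apply/stabE; exact: (bN 1%R).
have conj0 t u : shifts u 0 -> shifts (t * u * t^-1) 0.
  have [m' tm] := tr t => u0.
  by have := shiftsM (shiftsM tm u0) (shiftsV tm); rewrite addr0 subrr.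
have decE h : exists q i, h = zpow tau q * zpow b i.
  have [m' hm'] := tr h; have [q [u [-> /shiftE [i ->]]]] := dec tau tauk h m' hm'.
  by exists q, i.
have free q i : zpow tau q * zpow b i = 1 -> q = 0%R /\ i = 0%R.
  move=> E; have q0 : q = 0%R.
    have := shiftsM (shifts_zpow q tauk) (shifts_zpow i b0).
    by rewrite E => /(shifts_uniq shifts1); nia.
  by move: E; rewrite q0 zpow0 mul1g => /binf.
have gen h : exists i j, h = zpow b i * zpow tau j.
  have [q [i E]] := decE h^-1; exists (- i)%R, (- q)%R.
  by rewrite !zpowN -invgM -E invgK.
have free' i j : zpow b i * zpow tau j = 1 -> i = 0%R /\ j = 0%R.
  move=> E; have : zpow tau (- j)%R * zpow b (- i)%R = 1.
    by rewrite !zpowN -invgM E invg1.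
  by move=> /free; lia.
have [i bi] := shiftE _ (conj0 tau b b0).
have [j bj] := shiftE _ (conj0 tau^-1 b b0).
have : (j * i = 1)%R.
  suff : (j * i - 1 = 0)%R by lia.
  apply: binf; rewrite zpowP zpowM -bj zpow_conj -bi invgK !mulgA mulVg mul1g.
  by rewrite mulgVK mulgV.
rewrite mulrC => /mulz_eq1_unit [] Ei; rewrite {}Ei ?zpow1 ?zpowN1 in bi.
  by apply: Or32; apply: (Z2P bi gen free').
by apply: Or33; apply: (klein_bottleP bi gen free').
Qed.

End LineAction.

(** * Elliptic subgroups *)

Section Ellipticity.
Local Open Scope group_scope.
Variable G : groupType.

Lemma subgroup_power (H K : set G) x : infinite_cyclic H -> infinite_cyclic K ->
  K `<=` H -> H x -> exists2 n : int, n <> 0%R & K (zpow x n).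
Proof.
move=> /infinite_cyclicP [z [_ Hz _]] /infinite_cyclicP [y [Ky _ yinf]] KH Hx.
have [m ym] : exists m, y = zpow z m by apply/Hz/KH; exact: (Ky 1%R).
have [i xi] := Hz x Hx; exists m.
  move=> m0; suff : (1 = 0 :> int)%R by [].
  by apply: yinf; rewrite zpow1 ym m0.
by rewrite xi -zpowM mulrC zpowM -ym.
Qed.

Lemma estab_org (T : Ggraph G) (e : edge T) : estab e `<=` vstab (org e).
Proof. by move=> g ge; rewrite /vstab /= -eact_org ge. Qed.

Lemma estab_tgt (T : Ggraph G) (e : edge T) : estab e `<=` vstab (tgt e).
Proof. by move=> g ge; rewrite /vstab /= -eact_tgt ge. Qed.

(** Vertex stabilizers are commensurable: adjacent ones share an edge stabilizer,
which has finite index in both. *)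
Lemma vstab_power (T : Ggraph G) (v w : vert T) x : cyclic_deformation_space T ->
  vstab v x -> exists2 n : int, n <> 0%R & vstab w (zpow x n).
Proof.
move=> [[tT _ _] vc ec] vx; have [p] := tree_connected tT v w.
elim: p v x vx => [|e p IH] v x vx /=; first by move<-; exists 1%R.
move=> [_ ev pw]; rewrite -ev in vx.
have [m m0 em] := subgroup_power (vc _) (ec e) (@estab_org _ e) vx.
have [n n0 wn] := IH _ _ (estab_tgt em) pw.
by exists (m * n)%R; [nia|rewrite zpowM].
Qed.

(** Otherwise a generator z of the stabilizer of v has an axis in S.  For h in G,
the elements z and h z h^-1 have a common nontrivial power, so their axes
coincide and the axis of z is invariant.  By minimality S is a line. *)
Lemma vstab_elliptic (S T : Ggraph G) (v : vert T) : ~ elementary G ->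
  cyclic_deformation_space S -> cyclic_deformation_space T ->
  exists s : vert S, vstab v `<=` vstab s.
Proof.
move=> nel SD TD; have [_ vcT _] := TD; have [[tS noinv minS] _ _] := SD.
have [z [vz zv zinf]] := infinite_cyclicP (vcT v).
have [[s zs]|nofix] := pselect (exists s : vert S, vact z s = s).
  exists s => _ /zv [n ->]; rewrite /vstab /=.
  elim/int_rect: n => [|n IH|n IH]; first by rewrite zpow0 vact1.
    by rewrite PoszS zpowS vactM zs.
  by rewrite PoszS opprD zpowP vactM -{1}zs vactK.
have [l al] : exists l, axis_line (T := S) z l.
  by apply: axis_exists => // w zw; apply: nofix; exists w.
have ll := axis_line_line al; have [k k0 zl] := axis_line_zpow al.
(* If l n is not on the translate of the line by h, then it separates no two
   vertices of this translate.  The common power of z and h z h^-1 moves these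
   vertices along the translate, while its inverse moves l n along l, so that a
   vertex would be on the same side of edges l m with m arbitrarily large and
   arbitrarily small. *)
have inv h n : exists m, l n = eact h (l m) \/ l n = bar (eact h (l m)).
  have vy : vstab (vact h v) (h * z * h^-1).
    by rewrite /vstab /= !vactM vactK (vz 1%R : vact z v = v).
  have [n1 n10 vn1] := vstab_power (vact h v) TD (vz 1%R).
  have [w [_ Hw winf]] := infinite_cyclicP (vcT (vact h v)).
  have [i Ei] := Hw _ vn1; have [j Ej] := Hw _ vy.
  rewrite zpow1 in Ei.
  have i0 : i <> 0%R.
    by move=> i0; rewrite i0 in Ei; exact: n10 (zinf _ Ei).
  have j0 : j <> 0%R.
    move=> j0; rewrite j0 zpow0 in Ej; suff : (1 = 0 :> int)%R by [].
    apply: zinf; rewrite zpow1; apply: (mulgI h); apply: (mulIg h^-1).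
    by rewrite Ej mulg1 mulgV.
  have com c : h * zpow z (i * c)%R * h^-1 = zpow z (n1 * j * c)%R.
    by rewrite -zpow_conj Ej -zpowM -mulrA (zpowM z) Ei -zpowM mulrCA.
  apply: contrapT => /forallNP sep; have {sep} off m : avoid (l n) (eact h (l m)).
    split=> E; apply: (sep m); first by left.
    by right; rewrite E barK.
  have const m : side (l n) (org (eact h (l m))) <-> side (l n) (org (eact h (l 0%R))).
    have step c : side (l n) (org (eact h (l c))) <->
        side (l n) (org (eact h (l (c + 1)%R))).
      by rewrite (side_edge (off c)) eact_tgt (ll c).1 -eact_org.
    elim/int_rect: m => [//|m IH|m IH]; first by rewrite PoszS -step.
    by rewrite PoszS opprD step subrK.
  have orbit c : side (l (n - k * (n1 * j * c))%R) (org (eact h (l 0%R)))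
      <-> side (l n) (org (eact h (l 0%R))).
    rewrite -[X in _ <-> X](const (k * (i * c))%R) -(add0r (k * (i * c))%R) -zl.
    rewrite -eactM; have -> : h * zpow z (i * c)%R = zpow z (n1 * j * c)%R * h.
      by rewrite -com mulgVK.
    by rewrite eactM (eact_org (zpow _ _)) side_actr -zpowN zl mulrN.
  have [m0 far] := line_sides tS (org (eact h (l 0%R))) ll.
  have a0 : (n1 * j)%R <> 0%R by nia.
  (* sg is the sign of the exponent n1 * j, and c is large *)
  pose c := Posz (`|n| + m0); pose sg := (if (0 < n1 * j)%R then 1 else -1)%R : int.
  have big : (Posz (`|n| + m0) <= k * (n1 * j * (sg * c)))%R.
    have B1 : (1 <= n1 * j * sg)%R by rewrite /sg; case: ifP; lia.
    have kB : (1 <= k * (n1 * j * sg))%R.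
      by move: B1 k0; move: (n1 * j * sg)%R => B; nia.
    rewrite (mulrA (n1 * j)%R) mulrA -/c; move: kB; move: (k * _)%R => B B0.
    have : (0 <= c)%R by []; nia.
  have low := (far (n - k * (n1 * j * (sg * c)))%R).2.
  have high := (far (n - k * (n1 * j * - (sg * c)))%R).1.
  move: low high; rewrite !orbit => low high; apply: low.
    by move: big; rewrite /c; lia.
  by apply: high; move: big; rewrite /c !mulrN; lia.
exfalso; apply: nel.
pose E : set (edge S) := [set e | exists n, e = l n \/ e = bar (l n)].
have Ebar e : E e -> E (bar e).
  by move=> [n [->|->]]; exists n; rewrite ?barK; [right|left].
pose V : set (vert S) := [set v | exists n, v = org (l n)].
have Eorg e : E e -> V (org e).
  move=> [n [->|->]]; first by exists n.
  by exists (n + 1)%R; rewrite -(ll n).1.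
pose F := Subgraph Ebar Eorg.
have EF h e : E e -> E (eact h e).
  by move=> [n En]; have [m Em] := inv h^-1 n; exists m;
    case: En => ->; case: Em => ->; rewrite ?eact_bar ?barK eactVK;
    by [left|right].
have tF : is_subtree F.
  split; first by exists (org (l 0%R)), 0%R.
    have conn n : exists p, walk (se F) (org (l 0%R)) p (org (l n)).
      elim/int_rect: n => [|n [p pn]|n [p pn]]; first by exists [::].
        exists (p ++ [:: l n]); apply: walk_cat pn _; rewrite PoszS -(ll _).1.
        by split=> //; exists (Posz n); left.
      exists (p ++ [:: bar (l (- n%:Z - 1)%R)]); apply: walk_cat pn _.
      rewrite PoszS opprD; split; rewrite ?tgt_bar //.
        by exists (- n%:Z - 1)%R; right.
      by rewrite -/(tgt _) (ll _).1 subrK.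
    move=> _ _ [n ->] [m ->]; have [p pn] := conn n; have [q qm] := conn m.
    by exists (rev (map (@bar S) p) ++ q); apply: walk_cat qm; exact: walk_rev pn.
  move=> w p pw; case: tS => _ _; apply; exact: walk_sub pw.
have [|_ FE] := minS F tF.
  split=> [h w [n ->]|h e]; last exact: EF.
  by rewrite -eact_org; apply: (Eorg _); apply: (EF _ _); exists n; left.
apply: (line_elementary SD ll _ k0).
  by move=> e; have : se F e by rewrite FE.
by move=> n; have := zl 1%R n; rewrite zpow1 mulr1; exact.
Qed.

Lemma loxodromic_no_fix (T : Ggraph G) g : ~ elementary G -> loxodromic g ->
  cyclic_deformation_space T -> forall v : vert T, vact g v <> v.
Proof.
move=> nel [T0 T0D nofix] TD v gv.
have [s sP] := vstab_elliptic v nel T0D TD.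
exact: (nofix (inl s)) (sP g gv).
Qed.

Lemma loxodromic_axis (T : Ggraph G) g : ~ elementary G -> loxodromic g ->
  cyclic_deformation_space T -> exists l, axis_line (T := T) g l.
Proof.
move=> nel gl TD; have [[tT noinv _] _ _] := TD.
by apply: axis_exists => //; exact: loxodromic_no_fix.
Qed.

End Ellipticity.

(** * Finitely many edge orbits, and equivariant maps *)

Section Cocompact.
Local Open Scope group_scope.
Variable G : groupType.

Definition generates (L : seq G) := forall A : set G, A 1 ->
  (forall h s, List.In s L -> A h -> A (h * s) /\ A (h * s^-1)) -> forall x, A x.

Lemma finite_type_list (X : Type) : finite_set [set: X] ->
  exists L : seq X, forall x, List.In x L.
Proof.
move=> [n /card_set_bijP [f [fn finj fsurj]]].
suff : forall m, m <= n -> exists L : seq X, forall x, f x < m -> List.In x L.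
  by move=> /(_ n (leqnn n)) [L LP]; exists L => x; apply: LP; exact: fn.
elim=> [|m IH] mn; first by exists [::].
have [L LP] := IH (ltnW mn); have [x _ fx] := fsurj m mn.
exists (x :: L) => y; rewrite ltnS leq_eqVlt => /orP[/eqP fy|/LP]; last by right.
by left; apply: finj; rewrite ?inE // fx fy.
Qed.

Lemma GBS_generated : GBS G -> exists L, generates L.
Proof.
move=> [Y [[fv fe] vc _ [B [_ [f [sur rel]]]]]].
have [LV LVP] := finite_type_list fv; have [LE LEP] := finite_type_list fe.
have fM v (x y : vgroup v) :
    f (pi1_vertex (x * y)) = f (pi1_vertex x) * f (pi1_vertex y).
  have /rel : word_eq (pi1_relator B) [:: (pi1_vertex x, false); (pi1_vertex y, false);
      (pi1_vertex (x * y), true)] [::].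
    exact: (@word_eq_relator _ _ [::] _ [::] (pi1_mul B x y)).
  rewrite /= mulg1 mulgA => E; apply: (mulIg (f (pi1_vertex (x * y)))^-1).
  by rewrite mulgV E.
have vgen v : exists s, forall y : vgroup v, exists n, f (pi1_vertex y) = zpow s n.
  have [z [_ zP _]] := infinite_cyclicP (vc v).
  exists (f (pi1_vertex z)) => y; have [n ->] := zP y I; exists n.
  have f1 : f (pi1_vertex (1 : vgroup v)) = 1.
    by apply: (mulgI (f (pi1_vertex (1 : vgroup v)))); rewrite -fM !mulg1.
  have fV (x : vgroup v) : f (pi1_vertex x^-1) = (f (pi1_vertex x))^-1.
    by apply: (mulgI (f (pi1_vertex x))); rewrite -fM !mulgV.
  elim/int_rect: n => [|n IH|n IH]; first by rewrite !zpow0.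
    by rewrite PoszS !zpowS fM IH.
  by rewrite PoszS opprD !zpowP fM fV IH.
have [s sP] := choice vgen.
exists (List.app (List.map s LV) (List.map (fun e => f (pi1_stable e)) LE)).
move=> A A1 AM.
have Az h t n :
    (forall h, A h -> A (h * t) /\ A (h * t^-1)) -> A h -> A (h * zpow t n).
  move=> At Ah; elim/int_rect: n => [|n IH|n IH]; first by rewrite zpow0 mulg1.
    by rewrite PoszS zpowS mulgA; exact: (At _ IH).1.
  by rewrite PoszS opprD zpowP mulgA; exact: (At _ IH).2.
have Af h a n : A h -> A (h * zpow (f a) n).
  move=> Ah; case: a => [[v y]|e].
    have [m Em] := sP v y; rewrite -/(pi1_vertex y) Em -zpowM; apply: Az => // k.
    by apply: AM; apply/List.in_or_app; left; apply: List.in_map; exact: LVP.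
  apply: Az => // k; apply: AM; apply/List.in_or_app; right.
  by apply: (List.in_map (fun e => f (pi1_stable e))); exact: LEP.
suff main w h : A h -> A (h * word_val f w).
  by move=> x; have [w <-] := sur x; rewrite -[word_val _ _]mul1g; exact: main.
elim: w h => [|[a b] w IH] h Ah /=; first by rewrite mulg1.
rewrite mulgA; apply: IH; case: b.
  by rewrite -zpowN1; exact: Af.
by rewrite -[f a]zpow1; exact: Af.
Qed.

Lemma walk_in (Y : graph) (B : set (edge Y)) u p v : walk setT u p v ->
  (forall a, List.In a p -> B a) -> walk B u p v.
Proof.
elim: p u => [|e p IH] u //= [_ eu pv] pB; split=> //; first by apply: pB; left.
by apply: IH => // a ap; apply: pB; right.
Qed.

(** The translates of walks from v0 to s v0, for s in a finite generating set, span
an invariant subtree. *)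
Lemma edge_orbits (T : Ggraph G) L : is_Gtree T -> generates L ->
  exists E0 : seq (edge T), forall e, exists e0 h,
    List.In e0 E0 /\ (e = eact h e0 \/ e = bar (eact h e0)).
Proof.
move=> [tT _ minT] gen; have [[v0 _] _ _] := tT.
have [E0 E0P] : exists E0 : seq (edge T), forall s, List.In s L ->
    exists p, walk setT v0 p (vact s v0) /\ forall a, List.In a p -> List.In a E0.
  elim: (L) => [|s L' [E0 IH]]; first by exists [::].
  have [p pv] := tree_connected tT v0 (vact s v0).
  exists (List.app p E0) => t [<-|/IH [q [qv qE]]].
    by exists p; split=> // a ap; apply/List.in_or_app; left.
  by exists q; split=> // a aq; apply/List.in_or_app; right; exact: qE.
exists E0.
pose E : set (edge T) := [set e | exists e0 h,
    List.In e0 E0 /\ (e = eact h e0 \/ e = bar (eact h e0))].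
have Ebar e : E e -> E (bar e).
  move=> [e0 [h [e0E [->|->]]]]; exists e0, h; split=> //; first by right.
  by left; rewrite barK.
have EG h e : E e -> E (eact h e).
  move=> [e0 [k [e0E [->|->]]]]; exists e0, (h * k); split=> //.
    by left; rewrite eactM.
  by right; rewrite eactM !eact_bar.
pose V : set (vert T) := [set w | exists p, walk E v0 p w].
pose D : set (edge T) := [set e | E e /\ V (org e)].
have VD u p w : V u -> walk E u p w -> walk D u p w.
  elim: p u => [|e p IH] u //= Vu [Ee eu pw]; rewrite -eu in Vu; split=> //.
  apply: IH pw; have [q qe] := Vu; exists (q ++ [:: e]).
  by apply: walk_cat qe _.
have Vtgt e : E e -> V (org e) -> V (tgt e).
  by move=> Ee [q qe]; exists (q ++ [:: e]); apply: walk_cat qe _.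
have Dbar e : D e -> D (bar e).
  by move=> [Ee Ve]; split; [exact: Ebar|exact: Vtgt].
have Dorg e : D e -> V (org e) by case.
pose F := Subgraph Dbar Dorg.
have Vv0 h : V (vact h v0).
  apply: (gen (fun h => V (vact h v0))); first by exists [::]; rewrite vact1.
  move=> k s sL [q qk]; have [p [pv pE]] := E0P s sL.
  have pEE c : walk E (vact c v0) (map (eact c) p) (vact (c * s) v0).
    rewrite vactM; apply: (walk_image (B := E)); first exact: EG.
    apply: walk_in pv _ => a /pE aE; exists a, 1; split=> //; left.
    by rewrite eact1.
  split; first by exists (q ++ map (eact k) p); exact: walk_cat qk (pEE k).
  exists (q ++ rev (map (@bar T) (map (eact (k * s^-1)) p))); apply: walk_cat qk _.
  by apply: walk_rev => //; have := pEE (k * s^-1); rewrite mulgVK.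
have VG h w : V w -> V (vact h w).
  move=> [p pw]; have [q qh] := Vv0 h; exists (q ++ map (eact h) p).
  by apply: walk_cat qh _; apply: walk_image pw; exact: EG.
have tF : is_subtree F.
  split; first by exists v0, [::].
    move=> u w [p pu] [q qw]; exists (rev (map (@bar T) p) ++ q).
    apply: walk_cat (VD _ _ _ _ qw); last by exists [::].
    by apply: walk_rev => //; apply: VD pu; exists [::].
  by move=> w p pw; case: tT => _ _; apply; exact: walk_sub pw.
have [|_ FE] := minT F tF; last by move=> e; have : se F e by [rewrite FE]; case.
split=> [h w|h e [Ee Ve]]; first exact: VG.
by split; [exact: EG|rewrite eact_org; exact: VG].
Qed.

(** Representatives of the orbits are chosen as a function of the orbit, a set of
vertices, so that all vertices of an orbit have the same representative. *)
Lemma equivariant_map (T S : Ggraph G) : is_tree T ->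
  (forall v : vert T, exists s : vert S, vstab v `<=` vstab s) ->
  exists f : vert T -> vert S, forall h v, f (vact h v) = vact h (f v).
Proof.
move=> [[v0 _] _ _] /choice [s sP].
have /choice [F FP] : forall A : set (vert T), exists v, A !=set0 -> A v.
  move=> A; have [[v Av]|nA] := pselect (A !=set0); first by exists v.
  by exists v0.
pose orb (v : vert T) : set (vert T) := [set w | exists h, w = vact h v].
have orbE h v : orb (vact h v) = orb v.
  apply/seteqP; split=> w [k ->]; first by exists (k * h); rewrite vactM.
  by exists (k * h^-1); rewrite vactM vactK.
have : forall v, exists h, v = vact h (F (orb v)).
  move=> v; have [|h Eh] := FP (orb v); first by exists v, 1; rewrite vact1.
  by exists h^-1; rewrite Eh vactK.
move=> /choice [c cP].
exists (fun v => vact (c v) (s (F (orb v)))) => h v; rewrite orbE.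
have : vstab (s (F (orb v))) ((h * c v)^-1 * c (vact h v)).
  apply: sP; rewrite /vstab /= vactM; have := cP (vact h v); rewrite orbE => <-.
  by rewrite -[RHS](vactK (h * c v)) vactM -cP.
by rewrite /vstab /= vactM => E; rewrite -vactM -{2}E vactVK.
Qed.

Lemma walk_separates (Y : graph) (e : edge Y) p u v : walk setT u p v ->
  ~ (side e u <-> side e v) -> exists2 a, List.In a p & (a = e \/ a = bar e).
Proof.
move=> pv ne; apply: contrapT => h; apply: ne; apply: (side_walk (p := p)).
apply: walk_in pv _ => a ap; split=> E; apply: h; exists a => //; first by left.
by right.
Qed.

(** Let q be a walk from f (org e0) to f (tgt e0).  The colour changes along h e0
only if h^-1 e or its opposite is one of the finitely many edges of q, and two
elements h for which h^-1 e is the same edge differ by the stabilizer of e,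
which preserves the distance to r. *)
Lemma bounded_cut (T S : Ggraph G) (f : vert T -> vert S) (e : edge S)
    (r : vert T) (E0 : seq (edge T)) :
  is_tree T -> is_tree S -> (forall h v, f (vact h v) = vact h (f v)) ->
  estab e `<=` vstab r ->
  (forall a, exists e0 h, List.In e0 E0 /\ (a = eact h e0 \/ a = bar (eact h e0))) ->
  exists N, forall a, ~ (side e (f (org a)) <-> side e (f (tgt a))) ->
    dist r (org a) <= N.
Proof.
move=> tT tS feq er EP.
have aux (Y : seq (edge S)) (z : vert T) : exists N, forall h,
    List.In (eact h^-1 e) Y -> dist r (vact h z) <= N.
  elim: Y => [|y Y [N IH]]; first by exists 0.
  have [[h0 h0y]|no] := pselect (exists h0, eact h0^-1 e = y); last first.
    by exists N => h [hy|/IH //]; case: no; exists h.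
  exists (maxn N (dist r (vact h0 z))) => h [hy|/IH hN]; last by rewrite leq_max hN.
  have : vstab r (h * h0^-1).
    by apply: er; rewrite /estab /= eactM h0y hy eactVK.
  rewrite /vstab /= => hr; rewrite leq_max; apply/orP; right.
  by have := dist_act tT (h * h0^-1) r (vact h0 z); rewrite hr -vactM mulgVK => ->.
have {aux} : exists N, forall e0, List.In e0 E0 -> forall h,
    ~ (side e (f (vact h (org e0))) <-> side e (f (vact h (tgt e0)))) ->
    dist r (vact h (org e0)) <= N /\ dist r (vact h (tgt e0)) <= N.
  elim: (E0) => [|b E1 [N IH]]; first by exists 0.
  have [q qv] := tree_connected tS (f (org b)) (f (tgt b)).
  pose Y := List.app q (List.map (@bar S) q).
  have [N1 N1P] := aux Y (org b); have [N2 N2P] := aux Y (tgt b).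
  exists (maxn N (maxn N1 N2)) => e0 [<-|/IH {}IH] h sep; last first.
    by have [h1 h2] := IH h sep; rewrite !leq_max h1 h2.
  suff hY : List.In (eact h^-1 e) Y.
    by rewrite !leq_max (N1P _ hY) (N2P _ hY) !orbT.
  have {}sep : ~ (side (eact h^-1 e) (f (org b)) <-> side (eact h^-1 e) (f (tgt b))).
    by rewrite -!side_actr -!feq.
  have [a aq [ae|ae]] := walk_separates qv sep; apply/List.in_or_app.
    by left; rewrite -ae.
  by right; rewrite -(barK (eact _ _)) -ae; exact: List.in_map.
move=> [N NP]; exists N => a sep; have [e0 [h [e0E [Ea|Ea]]]] := EP a.
  by move: sep; rewrite Ea eact_tgt eact_org => /NP [].
have [] // := NP e0 e0E h.
by move=> iff; apply: sep; rewrite Ea tgt_bar eact_org -/(tgt _) eact_tgt iff.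
by rewrite Ea -/(tgt _) eact_tgt.
Qed.

End Cocompact.

(** * The colouring of T by the two half-trees of an edge of S *)

Section Geodesics.
Variable Y : graph.
Hypothesis tY : is_tree Y.

Lemma geodesic_separates p (v w : vert Y) a : walk setT v p w -> size p = dist v w ->
  List.In a p -> side a v /\ ~ side a w.
Proof.
elim: p v => [|e p IH] v //= [_ ev pw] sp.
have dtail : size p = dist (tgt e) w.
  have := dist_le tY pw; have := dist_triangle tY (tgt e) v w.
  by have := dist_edge tY e; rewrite ev; lia.
have nsw : ~ side e w.
  by move=> /(side_away tY); rewrite !(distC tY w) ev; lia.
case=> [<-|ap]; first by rewrite -ev; split=> //; exact: side_org.
have [sa nw] := IH _ pw dtail ap; split=> //.
apply: contrapT => nv.
have [ea|/not_andP] := pselect (avoid a e).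
  by move: nv; rewrite -ev (side_edge ea).
case=> /contrapT Ee; first by apply: nv; rewrite -ev Ee; exact: side_org.
have := dist_cross tY (side_org a) nw; rewrite distvv // add0n.
move: ev dtail; rewrite Ee tgt_bar -/(tgt a) => -> <-; lia.
Qed.

End Geodesics.

Section Cut.
Local Open Scope group_scope.
Variables (G : groupType) (T S : Ggraph G).
Hypotheses (tT : is_tree T) (tS : is_tree S) (minS : minimal_action S).
Variable f : vert T -> vert S.
Hypothesis fG : forall h v, f (vact h v) = vact h (f v).
Variables (g : G) (lT : int -> edge T) (lS : int -> edge S).
Hypotheses (gT : axis_line g lT) (gS : axis_line g lS).

Definition far_both (r : vert T) (c : vert T -> Prop) := forall M : nat,
  (exists2 w, c w & M < dist r w) /\ (exists2 w, ~ c w & M < dist r w).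

(** The edges e of S for which this holds are permuted by G, and they are convex:
if c separates two such edges a and b, then one half-tree of a and one half-tree
of b lie on different sides of c.  The axis of g consists of such edges, as the
powers of g push f r to both ends of the axis. *)
Lemma far_both_sides r (e : edge S) : far_both r (fun w => side e (f w)).
Proof.
pose good : set (edge S) := [set a | far_both r (fun w => side a (f w))].
have goodbar a : good a -> good (bar a).
  move=> ga M; have [[w sw Mw] [w' sw' Mw']] := ga M.
  by split; [exists w'|exists w] => //; rewrite side_bar.
have goodact h a : good a -> good (eact h a).
  move=> ga M; have [[w sw Mw] [w' sw' Mw']] := ga (M + dist r (vact h r)).
  have fardist u : M + dist r (vact h r) < dist r u -> M < dist r (vact h u).
    have := dist_triangle tT r (vact h r) (vact h u); rewrite dist_act //.
    by rewrite (distC tT (vact h r)); lia.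
  split; [exists (vact h w)|exists (vact h w')]; rewrite ?fG ?side_act //;
    exact: fardist.
pose V : set (vert S) := [set v | exists2 a, good a & v = org a].
have goodorg a : good a -> V (org a) by move=> ga; exists a.
pose F := Subgraph goodbar goodorg.
(* One of the half-trees of a does not contain b. *)
have extend a b : good a -> avoid a b -> forall M : nat,
    exists2 w, side b (f w) <-> side b (org a) & M < dist r w.
  move=> ga ab M.
  suff [a' [ga' ab' sb Ea']] : exists a', [/\ good a', avoid a' b, side a' (org b)
      & side b (tgt a') <-> side b (org a)].
    have [_ [w nw Mw]] := ga' M; exists w => //.
    by rewrite (side_beyond tS ab' sb nw).
  have [sb|nb] := pselect (side a (org b)).
    by exists a; split=> //; rewrite -(side_edge (avoidC ab)).
  exists (bar a); split=> //; first exact: (goodbar _).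
  - by rewrite avoid_of_bar.
  - by rewrite side_bar.
  - by rewrite tgt_bar.
have between a b c : good a -> good b -> side c (org a) -> ~ side c (org b) -> good c.
  move=> ga gb sa sb M.
  have mem d : good d -> ~ avoid d c -> good c.
    by move=> gd /not_andP [] /contrapT -> //; exact: (goodbar _).
  have [ac|nac] := pselect (avoid a c); last exact: (mem a ga nac M).
  have [bc|nbc] := pselect (avoid b c); last exact: (mem b gb nbc M).
  have [w Ew Mw] := extend a c ga ac M; have [w' Ew' Mw'] := extend b c gb bc M.
  by split; [exists w|exists w'] => //; rewrite ?Ew ?Ew'.
have tF : is_subtree F.
  split.
  - exists (org (lS 0%R)), (lS 0%R) => // M.
    have [k k0 gk] := axis_line_zpow gS.
    have [m0 far] := line_sides tS (f r) (axis_line_line gS).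
    have [j0 esc] := axis_escape tT r r M gT.
    have sideE j : side (lS 0%R) (f (vact (zpow g j) r)) <->
        side (lS (- (k * j))%R) (f r).
      by rewrite fG side_actr -zpowN gk mulrN add0r.
    split; [exists (vact (zpow g (- Posz (m0 + j0))%R) r)
           |exists (vact (zpow g (Posz (m0 + j0))) r)].
    + by rewrite sideE; apply: (far _).1; nia.
    + by apply: esc; lia.
    + by rewrite sideE; apply: (far _).2; nia.
    + by apply: esc; lia.
  - move=> _ _ [a ga ->] [b gb ->]; have [p pw sp] := dist_walk tS (org a) (org b).
    exists p; apply: (walk_in pw) => c cp.
    have [sa nb] := geodesic_separates tS pw sp cp.
    exact: between ga gb sa nb.
  - by move=> w p pw; case: tS => _ _; apply; exact: walk_sub pw.
have [|_ FE] := minS tF; last by have : se F e by rewrite FE.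
split=> [h v [a ga ->]|h a]; last exact: (goodact _).
by exists (eact h a); [exact: (goodact _)|rewrite eact_org].
Qed.

(** The vertices h g^j s0 are all on one side of e.  For |j| large, they are
farther from e than from h g^j (f u), as g is loxodromic in S. *)
Lemma axis_side (h : G) (e : edge S) (s0 : vert S) (u : vert T) :
  (forall j : int, side e (vact h (vact (zpow g j) s0)) <-> side e (vact h s0)) ->
  exists j0 : nat, forall j : int, j0 <= `|j|%N ->
    side e (f (vact h (vact (zpow g j) u))) <-> side e (vact h s0).
Proof.
move=> const.
have [j0 esc] := axis_escape tS (vact h^-1 (org e)) s0 (dist s0 (f u)) gS.
exists j0 => j /esc; rewrite ltnNge => /negP lt; apply: contrapT => ne; apply: lt.
rewrite -(dist_act tS h) vactVK (distC tS).
rewrite -[X in _ <= X](dist_act tS (h * zpow g j)) !vactM.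
by apply: dist_cross_le => // iff; apply: ne; rewrite -(const j) iff !fG.
Qed.

End Cut.

(** * The Whitehead graph *)

Section Whitehead.
Local Open Scope group_scope.
Variables (G : groupType) (T : Ggraph G) (g : G).
Hypothesis tT : is_tree T.
Variables (c : vert T -> Prop) (r : vert T) (N : nat).
Hypothesis cN : forall a : edge T, ~ (c (org a) <-> c (tgt a)) -> dist r (org a) <= N.
Hypothesis cfar : far_both r c.
Hypothesis caxis : forall h, exists C : Prop, forall l : int -> edge T,
  axis_line g l -> forall n : int,
  (exists m : int, [/\ (n < m)%R, N < dist r (vact h (org (l m)))
     & c (vact h (org (l m))) <-> C]) /\
  (exists m : int, [/\ (m < n)%R, N < dist r (vact h (org (l m)))
     & c (vact h (org (l m))) <-> C]).

Let pure (a : edge T) := forall w w', ~ side a w -> ~ side a w' ->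
  N < dist r w -> N < dist r w' -> c w -> c w'.

(* Beyond a there is no edge along which the colour changes. *)
Let deep_pure a : side a r -> N <= dist r (org a) -> pure a.
Proof.
move=> ar Na.
suff E w : ~ side a w -> c (tgt a) <-> c w.
  by move=> w w' nw nw' _ _; rewrite -(E w nw) -(E w' nw').
move=> nw; have [p] : side (bar a) w by rewrite side_bar.
rewrite avoid_of_bar -/(tgt a).
have : ~ side a (tgt a) by exact: side_tgt.
elim: p (tgt a) => [|b p IH] u nu /=; first by move->.
move=> [ab ub pw]; rewrite -ub in nu *.
have nt : ~ side a (tgt b) by rewrite -(side_edge ab).
rewrite -(IH _ nt pw); apply: contrapT => /cN.
by rewrite (dist_cross tT ar nu); lia.
Qed.

Let first_edge (v w : vert T) :
  v <> w -> exists a : edge T, [/\ org a = v & ~ side a w].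
Proof.
move=> vw; have [[|a p] pw sp] := dist_walk tT v w; first by case: vw.
have [_ na] := geodesic_separates tT pw sp (or_introl erefl).
by exists a; split=> //; case: pw.
Qed.

(* P is the set of edges at v that lead back to r: it is empty if v = r, and a
   single edge otherwise.  The vertices w and w' show the two colours.  If some
   edge pointing away from r is not pure, v is the end of a farthest one. *)
Let branching : exists (v : vert T) (P : set (edge T)) (w w' : vert T),
  [/\ forall a, org a = v -> ~ P a -> pure a,
      forall a b, P a -> P b -> a = b,
      [/\ c w, ~ c w', N < dist r w & N < dist r w']
    & (exists a, [/\ org a = v, ~ P a & ~ side a w]) /\
      (exists a, [/\ org a = v, ~ P a & ~ side a w'])].
Proof.
pose Q (n : nat) := `[< exists a, [/\ side a r, ~ pure a & dist r (org a) = n] >].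
have Qlt n : Q n -> n < N.
  move=> /asboolP [a [ar na <-]]; rewrite ltnNge; apply/negP => /(deep_pure ar).
  exact: na.
have [exQ|nQ] := pselect (exists n, Q n); last first.
  have [[w cw Nw] [w' cw' Nw']] := cfar N.
  have rn u : N < dist r u -> r <> u by move=> + E; rewrite -E distvv.
  exists r, set0, w, w'; split=> //.
    move=> a ar _; have sr : side a r by rewrite -ar; exact: side_org.
    apply: contrapT => na; apply: nQ; exists (dist r (org a)).
    by apply/asboolP; exists a.
  have [a [ar na]] := first_edge (rn _ Nw); have [b [br nb]] := first_edge (rn _ Nw').
  by split; [exists a|exists b]; split=> // -[].
case: (@ex_maxnP Q N exQ) => [n /Qlt/ltnW //|n Qn nmax].
have nN := Qlt n Qn; have /asboolP [e [er ne de]] := Qn.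
have [w [w' [nw nw' Nw Nw' [cw cw']]]] : exists w w', [/\ ~ side e w, ~ side e w',
    N < dist r w, N < dist r w' & c w /\ ~ c w'].
  apply: contrapT => none; apply: ne => w w' nw nw' Nw Nw' cw.
  by apply: contrapT => cw'; apply: none; exists w, w'.
have dt : dist r (tgt e) = n.+1 by rewrite side_away // de.
have tn u : N < dist r u -> tgt e <> u by move=> + E; rewrite -E dt; lia.
exists (tgt e), [set bar e], w, w'; split=> //.
- move=> a ta aP; have sr : side a r by apply: (side_nested tT (e := e)).
  apply: contrapT => na; have : Q n.+1 by apply/asboolP; exists a; rewrite ta.
  by move/nmax; rewrite ltnn.
- by move=> a b -> ->.
have nbar a u : ~ side a u -> ~ side e u -> ~ [set bar e] a.
  by move=> na nu E; apply: na; rewrite E side_bar.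
have [a [ta na]] := first_edge (tn _ Nw); have [b [tb nb]] := first_edge (tn _ Nw').
by split; [exists a|exists b]; split=> //; [exact: nbar nw|exact: nbar nw'].
Qed.

(* For a pure edge, this says which of the two colours is found beyond it. *)
Let reached (a : edge T) := exists w, [/\ ~ side a w, N < dist r w & c w].

(* The edges a and b lie on a translate of the axis, which leaves through each of
   them towards one of its ends; both ends have the colour C. *)
Let adj_reached a b : pure a -> pure b ->
  (exists h : G, [set a; b] `<=` [set eact h x | x in axis T g]) ->
  reached a -> reached b.
Proof.
move=> pa pb [h ab]; have [C CP] := caxis h.
have ray x : [set eact h x | x in axis T g] x ->
    exists w, [/\ ~ side x w, N < dist r w & c w <-> C].
  move=> [y [l al [n yn]] <-]; have ll := axis_line_line al.
  have [[m [nm Nm Cm]] [m' [nm' Nm' Cm']]] := CP l al n.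
  case: yn => ->.
    by exists (vact h (org (l m))); split=> //; rewrite side_act line_side //; lia.
  exists (vact h (org (l m'))); split=> //.
  by rewrite side_act side_bar // line_side //; lia.
move=> [w [nw Nw cw]].
have [w1 [nw1 Nw1 Cw1]] := ray a (ab a (or_introl erefl)).
have [w2 [nw2 Nw2 Cw2]] := ray b (ab b (or_intror erefl)).
by exists w2; split=> //; apply/Cw2/Cw1; exact: (pa w w1).
Qed.

(** Adjacency preserves the colour among the edges at v that do not lead back to
r, while both colours occur. *)
Lemma whitehead_cut : exists v : vert T, admissible_cut (Wh T g v).
Proof.
have [v [P [w [w' [star Puniq [cw cw' Nw Nw'] [[a [av nPa na]] [b [bv nPb nb]]]]]]]] :=
  branching.
exists v.
have ra : reached a by exists w.
have rb : ~ reached b.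
  by move=> [u [nu Nu cu]]; apply: cw'; exact: (star b bv nPb u w').
have step x y : org x = v -> org y = v -> ~ P x -> ~ P y ->
    adj (s := Wh T g v) x y -> reached x -> reached y.
  move=> xv yv nx ny [_ hxy].
  exact: adj_reached (star x xv nx) (star y yv ny) hxy.
have [dis|con] := pselect (disconnected (Wh T g v)); [by left|right].
have conn x y : org x = v -> org y = v -> connected_in (W := Wh T g v) x y.
  by move=> xv yv; apply: contrapT => nc; apply: con; exists x, y.
have [[p pv Pp]|noP] := pselect (exists2 p, org p = v & P p); last first.
  exfalso; apply: rb; move: ra.
  elim: (conn a b av bv) => [x y [xv yv xy]|//|x y z _ IH1 _ IH2 /IH1/IH2 //].
  by apply: step => // Px; apply: noP; [exists x|exists y].
exists p; split=> //; exists a, b; split.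
- by split=> //; split; [exact: conn|move=> ap; apply: nPa; rewrite ap].
- by split=> //; split; [exact: conn|move=> bp; apply: nPb; rewrite bp].
move=> cab; apply: rb; move: ra.
elim: cab => [x y [[xv [_ xp]] [yv [_ yp]] xy]|//|x y z _ IH1 _ IH2 /IH1/IH2 //].
by apply: step => //; [move=> Px; apply: xp|move=> Py; apply: yp]; exact: Puniq.
Qed.

End Whitehead.

(** A special factor that contains g is not an edge stabilizer, as g is
loxodromic, so it is the stabilizer of a component of an invariant forest; since
it is proper, some edge e is not in the forest.  The vertex s0 is taken in that
component, and e is not on the walks in the forest from s0 to g^j s0. *)
Lemma simple_missed_edge (G : groupType) (g : G) : ~ elementary G -> loxodromic g ->
  simple_element g -> exists S : Ggraph G, cyclic_deformation_space S /\
    exists (e : edge S) (s0 : vert S), forall (h : G) (j : int),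
      side e (vact h (vact (zpow g j) s0)) <-> side e (vact h s0).
Proof.
move=> nel gl [H [[[S [SD [F [invF [x Hx]]]]] _] HT Hg]].
exists S; split=> //.
have nofix := loxodromic_no_fix nel gl SD.
case: x Hx => [X|d] Hx; last first.
  exfalso; move: Hg; rewrite Hx /= /estab /= => /(congr1 val) /= gd.
  by apply: (nofix (org (val d))); rewrite -eact_org gd.
have [v0 _ Xv0] := set_mem (valP X).
have HE h : H h <-> component F (vact h v0) = component F v0.
  rewrite Hx /= /vstab /=; split=> [/(congr1 val)/=|E].
    by rewrite -Xv0 component_act.
  by apply: val_inj; rewrite /= -Xv0 component_act.
have [e Fe] : exists e, ~ se F e.
  apply: contrapT => /forallNP allF; apply: HT; apply/seteqP; split=> // h _.
  have all v : component F v = setT.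
    apply/seteqP; split=> // w _; have [[tS _ _] _ _] := SD.
    have [p pw] := tree_connected tS v w; exists p; apply: walk_in pw _ => a _.
    exact: contrapT (allF a).
  by rewrite HE !all.
exists e, v0 => h j.
have gj : component F (vact (zpow g j) v0) = component F v0.
  move/HE: Hg => g0.
  elim/int_rect: j => [|j IH|j IH]; first by rewrite zpow0 vact1.
    by rewrite PoszS zpowS vactM -component_act // g0 component_act // IH.
  have gV : component F (vact g^-1 v0) = component F v0.
    by rewrite -(component_act invF) -g0 (component_act invF) vactK.
  by rewrite PoszS opprD zpowP vactM -(component_act invF) gV (component_act invF).
have [p pw] : component F v0 (vact (zpow g j) v0).
  by rewrite -gj; exists [::].
apply: iff_sym; apply: (side_walk (p := map (eact h) p)).
apply: walk_image pw => a Fa; have Fha := invF.2 h a Fa.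
by split=> E; apply: Fe; [rewrite -E|rewrite -(barK e) -E; exact: se_bar].
Qed.

Theorem theorem1 (G : groupType) (g : G) :
  GBS G -> ~ elementary G -> loxodromic g -> simple_element g ->
  forall T : Ggraph G, cyclic_deformation_space T ->
    exists v : vert T, admissible_cut (Wh T g v).
Proof.
move=> gbs nel gl gsimple T TD.
have [S [SD [e [s0 const]]]] := simple_missed_edge nel gl gsimple.
have [GT _ _] := TD; have [tT _ _] := GT; have [[tS _ minS] _ _] := SD.
have [lT alT] := loxodromic_axis nel gl TD.
have [lS alS] := loxodromic_axis nel gl SD.
have [f fG] := equivariant_map tT (fun v => vstab_elliptic v nel SD TD).
have [r rP] := vstab_elliptic (org e) nel TD SD.
have er : estab e `<=` vstab r by move=> h /estab_org /rP.
have [L gen] := GBS_generated gbs.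
have [E0 E0P] := edge_orbits GT gen.
have [N cN] := bounded_cut tT tS fG er E0P.
apply: (whitehead_cut tT cN (far_both_sides tT tS minS fG alT alS r e)) => h.
exists (side e (vact h s0)) => l al n.
have [j1 side1] := axis_side tS fG alS (org (l 0%R)) (const h).
have [j2 far2] := axis_escape tT (vact (h^-1)%g r) (org (l 0%R)) N al.
have [k k0 lk] := axis_line_zpow al.
have at_j (j : int) : j1 <= `|j|%N -> j2 <= `|j|%N ->
    N < dist r (vact h (org (l (k * j)%R))) /\
    (side e (f (vact h (org (l (k * j)%R)))) <-> side e (vact h s0)).
  move=> /side1 + /far2; rewrite -(dist_act tT h) vactVK -eact_org lk add0r.
  by split.
pose j : int := (j1 + j2 + `|n| + 1)%N.
split; [exists (k * j)%R|exists (k * - j)%R].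
  have [] := at_j j; [rewrite /j; lia|rewrite /j; lia|].
  by split=> //; rewrite /j; nia.
have [] := at_j (- j)%R; [rewrite /j; lia|rewrite /j; lia|].
by split=> //; rewrite /j; nia.
Qed.
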